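(* Let $\lambda,c,L>0$, let $\Gamma=\{(x,y)\in\mathbb{R}^2:\ 0\le y\le L\}$, let $(X(t),Y(t))$ be the planar random motion with orthogonal directions $d_0,d_1,d_2,d_3$, velocity $c$ and switching rate $\lambda$, and let $\tau=\inf\{t>0:\ (X(t),Y(t))\notin\Gamma\}$. For $(x,y)\in\Gamma$ and $j=0,1,2,3$ put $$h_j(x,y)=\mathbb{E}\big[\tau\,\big|\,X(0)=x,\ Y(0)=y,\ D(0)=d_j\big],\qquad h(x,y)=\mathbb{E}\big[\tau\,\big|\,X(0)=x,\ Y(0)=y\big].$$ Then for all $x\in\mathbb{R}$ and $y\in[0,L]$, $$h_1(x,y)=\frac{\lambda y(L-y)}{c^2}+\frac{2(L-y)}{c},\qquad h_3(x,y)=\frac{\lambda y(L-y)}{c^2}+\frac{2y}{c}.$$ Consequently, $$h_0(x,y)=h_2(x,y)=\frac{\lambda y(L-y)}{c^2}+\frac{\lambda L+c}{\lambda c},\qquad h(x,y)=\frac{\lambda y(L-y)}{c^2}+\frac{2\lambda L+c}{2\lambda c}.$$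
   Context: Planar motion with orthogonal directions: the admissible directions are $d_j=(\cos(\pi j/2),\sin(\pi j/2))$, $j=0,1,2,3$ (indices modulo 4). At time $0$ the particle is at $(x,y)$ and picks one of the four directions with probability $\frac14$ each. It moves with constant speed $c>0$; at each event of a homogeneous Poisson process with intensity $\lambda>0$, independent of the initial direction, it turns from the current direction $d_j$ to $d_{j-1}$ or to $d_{j+1}$, each with probability $\frac12$, independently of everything else. $D(t)$ is the direction at time $t$. If the particle starts at $y=L$ with direction $d_1$ (up), or at $y=0$ with direction $d_3$ (down), then $\tau=0$. *)

(* Defs.v *)
From HB Require Import structures.
From mathcomp Require Import all_boot all_order all_algebra finmap.
From mathcomp Require Import all_classical all_reals all_analysis.

Set Implicit Arguments.
Unset Strict Implicit.
Unset Printing Implicit Defensive.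

Import Order.TTheory GRing.Theory Num.Theory.
Import numFieldNormedType.Exports.

Local Open Scope classical_set_scope.
Local Open Scope ring_scope.

Definition mutually_independent d (Omega : measurableType d) (R : realType)
    (P : probability Omega R) (I : choiceType)
    (F : I -> set (set Omega)) : Prop :=
  forall (J : {fset I}) (E : I -> set Omega),
    (forall i, i \in J -> F i (E i)) ->
    P (\bigcap_(i in [set` J]) E i) = (\prod_(i <- J) P (E i))%E.

(* E[Z | A] for an event A of positive probability. *)
Definition cond_expectation d (Omega : measurableType d) (R : realType)
    (P : probability Omega R) (Z : Omega -> \bar R) (A : set Omega) : \bar R :=
  (((fine (P A))^-1)%:E * \int[P]_(w in A) Z w)%E.

(* Directions are indexed by 'Z_4, so indices are automatically modulo 4. *)
Definition dir_vec (R : realType) (j : 'Z_4) : R * R :=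
  (cos (pi * (nat_of_ord j)%:R / 2), sin (pi * (nat_of_ord j)%:R / 2)).

Section sources.
Context d (Omega : measurableType d) (R : realType) (P : probability Omega R).
Variables (D0 : Omega -> 'Z_4) (W : nat -> {RV P >-> R})
  (turn : nat -> {RV P >-> bool}).

(* The sigma-algebras of the initial direction (None), of the n-th waiting
   time (Some (inl n)) and of the n-th turn (Some (inr n)). *)
Definition source_sigma (i : option (nat + nat)) : set (set Omega) :=
  match i with
  | None => preimage_set_system setT D0 discrete_measurable
  | Some (inl n) => preimage_set_system setT (W n) measurable
  | Some (inr n) => preimage_set_system setT (turn n) measurable
  end.

End sources.

(* The randomness driving the motion. The homogeneous Poisson process of
   intensity lambda is given by its independent Exp(lambda) waiting times;
   the n-th turn goes from d_j to d_(j+1) if [turn n] is true and to d_(j-1)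
   otherwise. *)
Record orthogonal_motion d (Omega : measurableType d) (R : realType)
    (P : probability Omega R) (lambda : R) := OrthogonalMotion {
  init_dir : Omega -> 'Z_4 ;
  waiting : nat -> {RV P >-> R} ;
  turn : nat -> {RV P >-> bool} ;
  init_dir_measurable : forall j, measurable (init_dir @^-1` [set j]) ;
  init_dir_uniform : forall j, P (init_dir @^-1` [set j]) = (4^-1)%:E ;
  waiting_exponential : forall n (B : set R), measurable B ->
    distribution P (waiting n) B = exponential_prob lambda B ;
  turn_fair : forall n b, P (turn n @^-1` [set b]) = (2^-1)%:E ;
  motion_independent :
    mutually_independent P (source_sigma init_dir waiting turn)
}.

Section motion.
Context d (Omega : measurableType d) (R : realType) (P : probability Omega R).
Variables (lambda : R) (M : orthogonal_motion P lambda).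

Definition event_time (n : nat) (w : Omega) : R :=
  \sum_(k < n.+1) waiting M k w.

(* Number of Poisson events in [0, t]; the set is almost surely finite, and
   the cardinal is 0 by convention when it is not. *)
Definition poisson_count (t : R) (w : Omega) : nat :=
  #|` fset_set [set n | event_time n w <= t] |.

Fixpoint dir_after (n : nat) (w : Omega) : 'Z_4 :=
  if n is m.+1
  then if turn M m w then dir_after m w + 1 else dir_after m w - 1
  else init_dir M w.

Definition direction (t : R) (w : Omega) : 'Z_4 :=
  dir_after (poisson_count t w) w.

Variable c : R.

Definition position (x y t : R) (w : Omega) : R * R :=
  (x + c * \int[lebesgue_measure]_(s in `[0, t]) (dir_vec R (direction s w)).1,
   y + c * \int[lebesgue_measure]_(s in `[0, t]) (dir_vec R (direction s w)).2).

Variable L : R.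

Definition strip : set (R * R) := [set p | 0 <= p.2 <= L].

(* The infimum of the empty set is +oo. *)
Definition exit_time (x y : R) (w : Omega) : \bar R :=
  ereal_inf [set t%:E | t in [set t : R | 0 < t /\ ~ strip (position x y t w)]].

Definition mean_exit_dir (j : 'Z_4) (x y : R) : \bar R :=
  cond_expectation P (exit_time x y) (init_dir M @^-1` [set j]).

Definition mean_exit (x y : R) : \bar R :=
  (\int[P]_w exit_time x y w)%E.

End motion.

(* Main.v *)
Require Import Defs.
From HB Require Import structures.
From mathcomp Require Import all_boot all_order all_algebra.
From mathcomp Require Import finmap ring lra.
From mathcomp Require Import all_classical all_reals all_analysis.
From mathcomp Require Import measurable_realfun.

(** Only the vertical coordinate matters, and between two Poisson events it
    moves with constant speed c, 0 or -c. Let Y_n and D_n be the height and the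
    direction right after the n-th event, let m_1, m_3 and m_0 = m_2 be the
    claimed mean exit times seen as functions of the height, and consider the
    Markov chain (D_n, Y_n) killed when it leaves the strip.

    The time tau is cut along the events: [stay n] is the time spent in the
    strip between the n-th and the (n+1)-st event. It is the n-th waiting time
    W_n, cut at the time needed to reach the boundary, and it is 0 once the
    particle has left. As tau is almost surely the sum of these times
    ([exit_time_stay]), only the sum of their expectations is needed.

    The claimed functions solve the one-step equation of the chain: with
    [remaining n] = m_(D_n)(Y_n) as long as the particle has stayed inside up
    to the n-th event, and 0 afterwards,
      E[stay n] + E[remaining (n+1)] = E[remaining n]
    on every event D_0 = j ([integral_step]). For a horizontal direction this
    is 1/lambda + (m_1 + m_3)/2 = m_0, since the next direction is up or down
    with probability 1/2. For the direction up, both possible next directions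
    have the same function m_0, so that the mean after the turn is m_0 whatever
    its outcome, and the equation becomes an integral of a quadratic polynomial
    against an exponential density ([integral_up_step]); the direction down
    follows by reflecting the strip.

    Summing the one-step equations telescopes: the sum of the first n terms
    E[stay k] is E[remaining 0] - E[remaining n]. The functions m_j are bounded
    on the strip, and to stay inside up to the event 2m+1 all the waiting times
    of the vertical phases (every other one) must be at most L/c, which has
    probability at most (1 - exp(-lambda L/c))^m. Hence E[remaining n] tends
    to 0 along odd n, and E[tau; D_0 = j] = m_j(y)/4.

    Two points of rigour. The infimum defining tau is only identified outside a
    null set and is not known to be measurable; the integral of a nonnegative
    function being a supremum over simple functions, this is harmless
    ([ge0_integral_eq_off_null]). And the independence of W_n and of the n-th
    turn from the past, which is given for finitely many events at a time, is
    extended to the sigma-algebra of the past by a pi-lambda argument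
    ([independent_sigma_algebra]) and then used through Fubini's theorem
    ([integral_independent_on]). *)

Set Implicit Arguments.
Unset Strict Implicit.
Unset Printing Implicit Defensive.

Import Order.TTheory GRing.Theory Num.Theory.
Import numFieldNormedType.Exports.

Local Open Scope classical_set_scope.
Local Open Scope ring_scope.

(** * Integrals of almost measurable functions and of densities *)

Section lower_integral.
Context d (T : measurableType d) (R : realType).
Variable mu : {measure set T -> \bar R}.
Local Open Scope ereal_scope.
Import HBNNSimple.

(** This is how nonmeasurable functions [f] are integrated here: a simple
    function below [f] can be set to 0 on the null set [N], after which it is
    below [g], and conversely. *)
Lemma ge0_integral_eq_off_null (D N : set T) (f g : T -> \bar R) :
  measurable D -> measurable N -> mu N = 0 -> measurable_fun D g ->
  (forall x, 0 <= f x) -> (forall x, 0 <= g x) ->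
  (forall x, D x -> ~ N x -> f x = g x) ->
  \int[mu]_(x in D) f x = \int[mu]_(x in D) g x.
Proof.
move=> mD mN N0 mg f0 g0 fg.
pose fD := f \_ D.
have fD0 x : 0 <= fD x by rewrite /fD patchE; case: ifP.
rewrite [LHS]integral_mkcond -/fD; apply/eqP; rewrite eq_le; apply/andP; split.
  rewrite ge0_integralTE//; apply: ge_ereal_sup => _ [h hf <-].
  rewrite -integralT_nnsfun.
  rewrite (ge0_negligible_integral mN)//; last 2 first.
  - exact/measurable_EFinP.
  - by move=> x _; rewrite lee_fin.
  rewrite setTD [leLHS]integral_mkcond [leRHS]integral_mkcond.
  apply: ge0_le_integral => //.
  - by move=> x _; rewrite patchE; case: ifP => // _; rewrite lee_fin.
  - apply/(measurable_restrictT _ _).1; first exact: measurableC.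
    by apply/measurable_funTS/measurable_EFinP.
  - exact/(measurable_restrictT _ _).1.
  - move=> x _; rewrite !patchE.
    case: ifPn => [/set_mem Nx|_]; last by case: ifP.
    by have := hf x; rewrite /fD patchE; case: ifPn => // /set_mem Dx; rewrite fg.
rewrite (ge0_negligible_integral mN)//.
rewrite [leLHS]integral_mkcond !ge0_integralTE//; last first.
  by move=> x; rewrite patchE; case: ifP.
apply: le_ereal_sup => _ [h hf <-]; exists h => // x.
apply: (le_trans (hf x)); rewrite /fD !patchE in_setD.
case: ifPn => [/andP[xD /negP xN]|_]; last by case: ifP.
rewrite xD fg//; first exact: set_mem.
by move=> Nx; apply: xN; exact: mem_set.
Qed.

End lower_integral.

Lemma integrable_setU d (T : measurableType d) (R : realType)
    (mu : {measure set T -> \bar R}) (A B : set T) (f : T -> \bar R) :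
  measurable A -> measurable B -> [disjoint A & B] ->
  mu.-integrable A f -> mu.-integrable B f -> mu.-integrable (A `|` B) f.
Proof.
move=> mA mB AB /integrableP[mfA fA] /integrableP[mfB fB].
have mf : measurable_fun (A `|` B) f by exact/measurable_funU.
apply/integrableP; split => //.
rewrite ge0_integral_setU//; first exact: lte_add_pinfty.
exact: measurableT_comp.
Qed.

Section density.
Context d (T : measurableType d) (R : realType).
Variables (nu : {finite_measure set T -> \bar R})
  (mu : {sigma_finite_measure set T -> \bar R}) (p : T -> R).
Hypotheses (p0 : forall x, 0 <= p x) (mp : measurable_fun setT p).
Local Open Scope ereal_scope.
Hypothesis nuE : forall A, measurable A -> nu A = \int[mu]_(x in A) (p x)%:E.

(** By uniqueness, the density agrees almost everywhere with the
    Radon-Nikodym derivative, for which the change of variables is known. *)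
Lemma ge0_integral_density (f : T -> \bar R) :
  measurable_fun setT f -> (forall x, 0 <= f x) ->
  \int[nu]_x f x = \int[mu]_x (f x * (p x)%:E).
Proof.
move=> mf f0.
have mpE A : measurable_fun A (EFin \o p) by exact/measurable_EFinP/measurable_funTS.
have dom : nu `<< mu.
  apply/null_content_dominatesP => A mA A0; rewrite nuE//.
  by rewrite (null_set_integral mA)//; exact: mpE.
rewrite -(Radon_Nikodym_SigmaFinite.change_of_variables dom)//.
apply: ge0_ae_eq_integral => //.
- apply: emeasurable_funM => //.
  exact: measurable_int (Radon_Nikodym_SigmaFinite.f_integrable dom).
- by apply: emeasurable_funM => //; exact: mpE.
- by move=> x _; rewrite mule_ge0// Radon_Nikodym_SigmaFinite.f_ge0.
- by move=> x _; rewrite mule_ge0// lee_fin.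
- apply: ae_eqe_mul2l; apply: integral_ae_eq => //.
  + exact: Radon_Nikodym_SigmaFinite.f_integrable.
  + by move=> E _ mE; rewrite -Radon_Nikodym_SigmaFinite.f_integral// nuE.
Qed.

End density.

(** * Independence of a sigma-algebra and a random variable *)

Section independence.
Context d (Omega : measurableType d) (R : realType) (P : probability Omega R).
Variables (I : choiceType) (F : I -> set (set Omega)).
Hypotheses (FI : forall i, setI_closed (F i)) (FT : forall i, F i setT)
  (Fm : forall i, F i `<=` measurable) (indepF : mutually_independent P F).

(** The pi-system generating the sigma-algebra of the sources with index in [Q]. *)
Definition cylinders (Q : I -> Prop) : set (set Omega) :=
  [set A | exists (J : {fset I}) (E : I -> set Omega),
    [/\ forall i, i \in J -> Q i, forall i, F i (E i) &
        A = \bigcap_(i in [set` J]) E i]].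

Lemma cylinders_measurable Q : cylinders Q `<=` measurable.
Proof.
by move=> _ [J [E [_ FE ->]]]; apply: fin_bigcap_measurable => // i _; exact: Fm.
Qed.

Lemma cylinders_setI Q : setI_closed (cylinders Q).
Proof.
move=> _ _ [J1 [E1 [Q1 FE1 ->]]] [J2 [E2 [Q2 FE2 ->]]].
exists (J1 `|` J2)%fset.
exists (fun i => (if i \in J1 then E1 i else setT) `&`
                 (if i \in J2 then E2 i else setT)); split.
- by move=> i; rewrite inE => /orP[/Q1|/Q2].
- by move=> i; apply: FI; case: ifP.
- apply/seteqP; split => [x [/= h1 h2] i /= iJ|x /= h].
    by split; case: ifP => // ij; [exact: h1|exact: h2].
  split=> i /= ij.
    by have [] := h i _; rewrite /= ?inE ?ij.
  by have [] := h i _; rewrite /= ?inE ?ij ?orbT.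
Qed.

Lemma cylinders_setT Q : cylinders Q setT.
Proof.
exists fset0, (fun=> setT); split => //.
by apply/seteqP; split.
Qed.

Lemma sub_cylinders (Q : I -> Prop) i E : Q i -> F i E -> cylinders Q E.
Proof.
move=> Qi FE; exists [fset i]%fset, (fun j => if j == i then E else setT); split.
- by move=> j; rewrite inE => /eqP->.
- by move=> j; case: ifP => // /eqP ->.
- apply/seteqP; split => [x Ex j /=|x /(_ i)/=]; first by rewrite inE => ->.
  by rewrite eqxx; apply; rewrite /= inE.
Qed.

(** The finite measures A |-> P (A `&` E) and A |-> P E * P A agree on the
    pi-system of cylinders, hence on the sigma-algebra that it generates. *)
Lemma independent_sigma_algebra Q A i E : ~ Q i -> <<s cylinders Q >> A ->
  F i E -> P (A `&` E) = (P A * P E)%E.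
Proof.
move=> Qi sA FE; have mE := Fm FE.
have PE0 : 0 <= fine (P E) by rewrite fine_ge0.
pose m1 : {measure set Omega -> \bar R} := mrestr P mE.
pose m2 : {measure set Omega -> \bar R} := mscale (NngNum PE0) P.
have m1E B : m1 B = P (B `&` E) by [].
have m2E B : m2 B = (P E * P B)%E.
  by rewrite /m2 /= /mscale /= fineK// fin_num_measure.
suff : m1 A = m2 A by rewrite m1E m2E muleC.
apply: (g_sigma_algebra_measure_unique (cylinders Q) _ (fun=> setT)) sA.
- exact: cylinders_measurable.
- by move=> _; exact: cylinders_setT.
- by rewrite bigcup_const//; exists 0%N.
- exact: cylinders_setI.
- move=> _ [J [G [QJ FG ->]]]; rewrite m1E m2E.
  have iJ : i \notin J by apply/negP => /QJ.
  pose G' k := if k == i then E else G k.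
  have G'J k : k \in J -> G' k = G k.
    by rewrite /G'; case: eqP => // ->; rewrite (negbTE iJ).
  have -> : (\bigcap_(k in [set` J]) G k) `&` E =
            \bigcap_(k in [set` (i |` J)%fset]) G' k.
    apply/seteqP; split => [x [h Ex] k /=|x h].
      rewrite !inE /G'; case: eqP => [//|_ /= kJ]; exact: h.
    split; last by have := h i; rewrite /G' eqxx; apply; rewrite /= !inE eqxx.
    by move=> k /= kJ; rewrite -(G'J _ kJ); apply: h; rewrite /= !inE kJ orbT.
  have FG' k : F k (G' k) by rewrite /G'; case: eqP => // ->.
  rewrite indepF => [|k _]; last exact: FG'.
  rewrite big_fsetU1//= {1}/G' eqxx; congr (_ * _)%E.
  rewrite indepF => [|k _]; last exact: FG.
  by apply: eq_big_seq => k kJ; rewrite G'J.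
- by move=> _; rewrite m1E (le_lt_trans _ (ltry 1))// probability_le1//;
    exact: measurableI.
Qed.

End independence.

Section independent_pair.
Context d1 d2 d3 (Omega : measurableType d1) (T1 : measurableType d2)
  (T2 : measurableType d3) (R : realType) (P : probability Omega R).
Variables (W : {RV P >-> T2}).
Local Open Scope ereal_scope.

(** Independence says that the law of the pair and the product of the laws
    agree on rectangles; Tonelli's theorem then integrates out [W]. *)
Lemma integral_independent_pair (X : {RV P >-> T1}) (f : T1 * T2 -> \bar R) :
  (forall A B, measurable A -> measurable B ->
    P (X @^-1` A `&` W @^-1` B) = P (X @^-1` A) * P (W @^-1` B)) ->
  measurable_fun setT f -> (forall z, 0 <= f z) ->
  \int[P]_w f (X w, W w) = \int[P]_w \int[distribution P W]_s f (X w, s).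
Proof.
move=> indep mf f0.
have mXW : measurable_fun setT (fun w => (X w, W w)).
  exact/measurable_fun_pair.
pose XW : {RV P >-> (T1 * T2)%type} := mfun_Sub (mem_set mXW).
transitivity (\int[distribution P XW]_z f z).
  by rewrite ge0_integral_distribution.
transitivity (\int[(distribution P X \x distribution P W)%E]_z f z).
  apply: eq_measure_integral => A mA _; apply/esym.
  exact: product_measure_unique.
rewrite fubini_tonelli1// /fubini_F.
rewrite ge0_integral_distribution//.
  exact: measurable_fun_fubini_tonelli_F.
by move=> x; apply: integral_ge0.
Qed.

End independent_pair.

Section integral_independent_on.
Context d1 d2 d3 (Omega : measurableType d1) (T1 : measurableType d2)
  (T2 : measurableType d3) (R : realType) (P : probability Omega R).
Variables (W : {RV P >-> T2}) (G : set (set Omega)).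
Hypotheses (Gm : G `<=` measurable).
Local Open Scope ereal_scope.
Hypothesis indep : forall A B, <<s G >> A -> measurable B ->
  P (A `&` W @^-1` B) = P A * P (W @^-1` B).

Lemma measurable_fun_sub_sigma d (T : measurableType d) (h : Omega -> T) :
  @measurable_fun _ _ (g_sigma_algebraType G) T setT h ->
  measurable_fun setT h.
Proof.
move=> mh _ B mB; have : <<s G >> ([set: Omega] `&` h @^-1` B).
  exact: mh measurableT B mB.
exact: (smallest_sub (@sigma_algebra_measurable _ Omega) Gm).
Qed.

(** Conditioning on the past: [U] and [X] are known from the sigma-algebra of
    [G], and [W] is independent of it. The event [U] is absorbed into the pair
    (1_U, X). *)
Lemma integral_independent_on (U : set Omega) (X : Omega -> T1)
    (f : T1 * T2 -> \bar R) :
  <<s G >> U -> @measurable_fun _ _ (g_sigma_algebraType G) T1 setT X ->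
  measurable_fun setT f -> (forall z, 0 <= f z) ->
  \int[P]_(w in U) f (X w, W w) =
  \int[P]_(w in U) \int[distribution P W]_s f (X w, s).
Proof.
move=> GU GX mf f0.
pose Z w : R * T1 := (\1_U w, X w).
have GZ : @measurable_fun _ _ (g_sigma_algebraType G) (R * T1)%type setT Z.
  exact: measurable_fun_pair.
pose ZV : {RV P >-> (R * T1)%type} :=
  mfun_Sub (mem_set (measurable_fun_sub_sigma GZ)).
pose f' (z : R * T1 * T2) := `|z.1.1|%:E * f (z.1.2, z.2).
have mf' : measurable_fun setT f'.
  apply: emeasurable_funM.
    apply/measurable_EFinP; apply: measurableT_comp => //.
    exact: measurableT_comp.
  apply: measurableT_comp => //; apply: measurable_fun_pair => //.
  exact: measurableT_comp.
have f'0 z : 0 <= f' z by rewrite mule_ge0// lee_fin.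
have patchZ (g : Omega -> \bar R) w : (g \_ U) w = `|\1_U w|%:E * g w.
  rewrite patchE indicE; case: ifPn => _ /=.
    by rewrite normr1 mul1e.
  by rewrite normr0 mul0e.
transitivity (\int[P]_w f' (ZV w, W w)).
  rewrite integral_mkcond; apply: eq_integral => w _.
  by rewrite patchZ.
rewrite integral_independent_pair//; last first.
  move=> A B mA mB; apply: indep => //.
  by have := GZ measurableT A mA; rewrite setTI.
rewrite [RHS]integral_mkcond; apply: eq_integral => w _.
rewrite patchZ -ge0_integralZl_EFin//.
exact: measurableT_comp.
Qed.

End integral_independent_on.

(** * Integrals of polynomials against an exponential density *)

Section exponential_moments.
Context (R : realType) (lambda : R).
Hypothesis lambda_gt0 : 0 < lambda.
Local Notation mu := (@lebesgue_measure R).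

Definition quad (A B C s : R) : R := A + B * s + C * s ^+ 2.

(** For p(s) = A + B s + C s^2, repeated integration by parts gives the
    primitive -exp(-lambda s) (p + p'/lambda + p''/lambda^2) of
    p(s) lambda exp(-lambda s). *)
Definition quad_primitive (A B C s : R) : R :=
  - expR (- lambda * s) *
  (A + B * s + C * s ^+ 2 + (B + 2 * C * s) / lambda + 2 * C / lambda ^+ 2).

Lemma is_derive_quad_primitive (A B C x : R) :
  is_derive x 1 (quad_primitive A B C)
    (quad A B C x * (lambda * expR (- lambda * x))).
Proof.
rewrite /quad_primitive /quad.
apply: is_derive_eq.
rewrite /GRing.scale /=; have l0 : lambda != 0 by rewrite gt_eqF.
by field.
Qed.

Lemma continuous_quad_exp (A B C : R) :
  continuous (fun x : R => quad A B C x * (lambda * expR (- lambda * x))).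
Proof.
move=> x; apply: cvgM.
  rewrite /quad.
  apply: cvgD; first apply: cvgD.
  - exact: cvg_cst.
  - apply: cvgM; [exact: cvg_cst|exact: cvg_id].
  - apply: cvgM; [exact: cvg_cst|exact: exprn_continuous].
apply: cvgM; first exact: cvg_cst.
apply: continuous_comp; last exact: continuous_expR.
exact: mulrl_continuous.
Qed.

Lemma continuous_quad_primitive (A B C : R) : continuous (quad_primitive A B C).
Proof.
move=> x; apply: differentiable_continuous; apply/derivable1_diffP.
by have [] := is_derive_quad_primitive A B C x.
Qed.

Lemma derive1_quad_primitive (A B C x : R) :
  derive1 (quad_primitive A B C) x = quad A B C x * (lambda * expR (- lambda * x)).
Proof.
by rewrite derive1E; have [_ ->] := is_derive_quad_primitive A B C x.
Qed.

Lemma integral_quad_exp (A B C a b : R) : a <= b ->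
  (\int[mu]_(x in `[a, b]) (quad A B C x * (lambda * expR (- lambda * x)))%:E
   = (quad_primitive A B C b - quad_primitive A B C a)%:E)%E.
Proof.
rewrite le_eqVlt => /predU1P[->|ab].
  by rewrite set_itv1 integral_set1 subrr.
rewrite (continuous_FTC2 (F := quad_primitive A B C))//.
- by apply: continuous_subspaceT; exact: continuous_quad_exp.
- split.
  + by move=> x _; have [] := is_derive_quad_primitive A B C x.
  + by apply: cvg_at_right_filter; exact: continuous_quad_primitive.
  + by apply: cvg_at_left_filter; exact: continuous_quad_primitive.
- by move=> x _; exact: derive1_quad_primitive.
Qed.

Lemma cvg_exp_decay (k : R) : 0 < k -> expR (- (k * x)) @[x --> +oo] --> (0 : R).
Proof.
move=> k0.
apply: (@cvg_comp _ _ _ (fun x => k * x) (fun x => expR (- x)) _ (+oo)).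
  by apply: gt0_cvgMry => //; exact: cvg_id.
exact: cvgr_expR.
Qed.

(** The term s exp(-lambda s) is squeezed between 0 and a multiple of
    exp(-lambda s/2), using lambda s/2 <= exp(lambda s/2). *)
Lemma cvg_linear_primitive (A B : R) :
  quad_primitive A B 0 x @[x --> +oo] --> 0.
Proof.
have xe0 : x * expR (- (lambda * x)) @[x --> +oo] --> (0 : R).
  apply: (@squeeze_cvgr _ _ _ _ (cst 0)
      (fun x => 2 / lambda * expR (- (lambda / 2 * x)))).
  - near=> x; have x0 : 0 <= x by near: x; exact: nbhs_pinfty_ge.
    rewrite mulr_ge0 ?expR_ge0//=.
    have -> : - (lambda * x) = - (lambda / 2 * x) + - (lambda / 2 * x) by field.
    rewrite expRD mulrA ler_pM2r ?expR_gt0//.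
    have h : lambda / 2 * x <= expR (lambda / 2 * x).
      by rewrite (le_trans _ (expR_ge1Dx _))// lerDr.
    rewrite expRN ler_pdivrMr ?expR_gt0//.
    rewrite [leLHS](_ : _ = 2 / lambda * (lambda / 2 * x)); last first.
      by field; rewrite gt_eqF.
    by rewrite ler_pM2l// divr_gt0.
  - exact: cvg_cst.
  - rewrite -[X in _ --> X](mulr0 (2 / lambda)).
    by apply: cvgM; [exact: cvg_cst|apply: cvg_exp_decay; rewrite divr_gt0].
have -> : quad_primitive A B 0 = (fun x => - (A + B / lambda) * expR (- (lambda * x))
    - B * (x * expR (- (lambda * x)))).
  apply/funext => x; rewrite /quad_primitive (mulNr lambda).
  by field; rewrite gt_eqF.
rewrite -[X in _ --> X](subr0 0) -{1}(mulr0 (- (A + B / lambda))) -{2}(mulr0 B).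
apply: cvgB; apply: cvgM;
  [exact: cvg_cst|exact: cvg_exp_decay|exact: cvg_cst|exact: xe0].
Unshelve. all: by end_near. Qed.

Lemma integral_linear_exp_y (A B a : R) : (forall x, a <= x -> 0 <= A + B * x) ->
  (\int[mu]_(x in `[a, +oo[) ((A + B * x) * (lambda * expR (- lambda * x)))%:E
   = (- quad_primitive A B 0 a)%:E)%E.
Proof.
move=> AB0.
have qE x : A + B * x = quad A B 0 x by rewrite /quad mul0r addr0.
under eq_integral do rewrite qE.
rewrite (@ge0_continuous_FTC2y _ _ (quad_primitive A B 0) a 0) ?sub0e ?sub0r//.
- by move=> x ax; rewrite -qE mulr_ge0 ?AB0// mulr_ge0 ?expR_ge0// ltW.
- by apply: continuous_subspaceT; exact: continuous_quad_exp.
- exact: cvg_linear_primitive.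
- by apply: cvg_at_right_filter; exact: continuous_quad_primitive.
- by move=> x _; exact: derive1_quad_primitive.
Qed.

End exponential_moments.

Section one_step_means.
Context (R : realType) (lambda c L : R).
Hypotheses (lambda_gt0 : 0 < lambda) (c_gt0 : 0 < c) (L_gt0 : 0 < L).
Local Notation mu := (@lebesgue_measure R).

(** The three candidates for the mean exit time, as functions of the height
    [y]: starting horizontally, upwards and downwards. *)
Definition mean_horizontal (y : R) : R :=
  lambda * y * (L - y) / c ^+ 2 + (lambda * L + c) / (lambda * c).

Definition mean_up (y : R) : R := lambda * y * (L - y) / c ^+ 2 + 2 * (L - y) / c.

Definition mean_down (y : R) : R := lambda * y * (L - y) / c ^+ 2 + 2 * y / c.

Lemma mean_horizontalC y : mean_horizontal (L - y) = mean_horizontal y.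
Proof. by rewrite /mean_horizontal; field; rewrite !gt_eqF. Qed.

Lemma mean_upC y : mean_up (L - y) = mean_down y.
Proof. by rewrite /mean_up /mean_down; field; rewrite gt_eqF. Qed.

Lemma mean_horizontal_ge0 y : 0 <= y <= L -> 0 <= mean_horizontal y.
Proof.
move=> /andP[y0 yL]; rewrite addr_ge0//.
  by rewrite divr_ge0 ?sqr_ge0// !mulr_ge0 ?subr_ge0// ltW.
by apply/ltW/divr_gt0; [apply: addr_gt0 => //; exact: mulr_gt0|exact: mulr_gt0].
Qed.

Lemma mean_up_ge0 y : 0 <= y <= L -> 0 <= mean_up y.
Proof.
move=> /andP[y0 yL]; rewrite addr_ge0//.
  by rewrite divr_ge0 ?sqr_ge0// !mulr_ge0 ?subr_ge0// ltW.
by apply: divr_ge0; rewrite ?mulr_ge0 ?subr_ge0// ltW.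
Qed.

Lemma mean_down_ge0 y : 0 <= y <= L -> 0 <= mean_down y.
Proof.
by move=> /andP[y0 yL]; rewrite -mean_upC mean_up_ge0// subr_ge0 yL/= lerBlDr lerDl.
Qed.

(** What a particle leaving height [y] upwards collects when the next event
    comes after a time [s]: the time spent in the strip until then, plus the
    mean exit time from the height that it has reached, in a horizontal
    direction, if it is still inside. The absolute value keeps the function
    nonnegative for all [s]. *)
Definition up_step (y s : R) : R :=
  Num.min `|s| ((L - y) / c) +
  if 0 <= y + c * s <= L then mean_horizontal (y + c * s) else 0.

Lemma up_step_ge0 y s : y <= L -> 0 <= up_step y s.
Proof.
move=> yL; rewrite addr_ge0//; last by case: ifP => // /mean_horizontal_ge0.
by rewrite le_min normr_ge0 divr_ge0 ?subr_ge0// ltW.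
Qed.

Lemma measurable_mean_horizontal : measurable_fun setT mean_horizontal.
Proof.
rewrite /mean_horizontal; apply: measurable_funD => //.
apply: measurable_funM => //; apply: measurable_funM.
  exact: measurable_funM.
exact: measurable_funB.
Qed.

Lemma measurable_mean_up : measurable_fun setT mean_up.
Proof.
rewrite /mean_up; apply: measurable_funD => //.
  apply: measurable_funM => //; apply: measurable_funM.
    exact: measurable_funM.
  exact: measurable_funB.
apply: measurable_funM => //; apply: measurable_funM => //.
exact: measurable_funB.
Qed.

Lemma measurable_mean_down : measurable_fun setT mean_down.
Proof.
rewrite /mean_down; apply: measurable_funD => //.
  apply: measurable_funM => //; apply: measurable_funM.
    exact: measurable_funM.
  exact: measurable_funB.
by apply: measurable_funM => //; exact: measurable_funM.
Qed.

Lemma measurable_up_step : measurable_fun setT (fun z : R * R => up_step z.1 z.2).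
Proof.
have mcs : measurable_fun setT (fun z : R * R => z.1 + c * z.2).
  by apply: measurable_funD => //; exact: measurable_funM.
apply: measurable_funD.
  apply: measurable_minr.
    exact: measurableT_comp.
  by apply: measurable_funM => //; exact: measurable_funB.
apply: measurable_fun_ifT => //.
  by apply: measurable_and; exact: measurable_fun_ler.
exact: (measurableT_comp measurable_mean_horizontal).
Qed.

(** The one-step equation for the direction up. With a = (L - y)/c, the time
    needed to reach the boundary, the integrand is a quadratic polynomial on
    `[0, a] and the constant a afterwards; the boundary terms at a cancel. *)
Lemma integral_up_step (y : R) : 0 <= y <= L ->
  (\int[mu]_(s in `[0%R, +oo[) (up_step y s * (lambda * expR (- lambda * s)))%:E
   = (mean_up y)%:E)%E.
Proof.
move=> /andP[y0 yL].
set a := (L - y) / c.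
have a0 : 0 <= a by rewrite divr_ge0 ?subr_ge0// ltW.
have yca : y + c * a = L by rewrite /a mulrC divfK ?gt_eqF// addrC subrK.
have mexp : measurable_fun [set: R] (fun s => lambda * expR (- lambda * s)).
  by apply: measurable_funM => //; apply: measurableT_comp => //;
    exact: measurable_funM.
have m : measurable_fun [set: R]
    (fun s => (up_step y s * (lambda * expR (- lambda * s)))%:E).
  apply/measurable_EFinP/measurable_funM => //.
  exact: (measurable_fun_pair2 y measurable_up_step).
have -> : `[0%R, +oo[%classic = `[0%R, a] `|` `]a, +oo[ :> set R.
  by rewrite -itv_bndbnd_setU.
rewrite ge0_integral_setU//=; last 3 first.
- exact: measurable_funTS.
- by move=> s _; rewrite lee_fin mulr_ge0 ?up_step_ge0// mulr_ge0 ?expR_ge0 ?ltW.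
- rewrite disj_set2E; apply/eqP/seteqP; split => // s /=.
  rewrite !in_itv/= andbT => -[/andP[_ sa] /(le_lt_trans sa)].
  by rewrite ltxx.
pose A := mean_horizontal y; pose B := 1 + lambda * (L - 2 * y) / c.
transitivity ((quad_primitive lambda A B (- lambda) a -
    quad_primitive lambda A B (- lambda) 0)%:E +
    (- quad_primitive lambda a 0 0 a)%:E)%E.
  congr (_ + _)%E.
    rewrite -integral_quad_exp//; apply: eq_integral => s.
    rewrite inE/= in_itv/= => /andP[s0 sa].
    have cs : y + c * s <= L by rewrite -yca lerD2l ler_pM2l.
    rewrite /up_step (ger0_norm s0) min_l// cs addr_ge0 ?mulr_ge0 ?(ltW c_gt0)//=.
    congr (_ * _)%:E; rewrite /quad /A /B /mean_horizontal; field.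
    by rewrite !gt_eqF.
  rewrite -integral_linear_exp_y//; last by move=> x _; rewrite mul0r addr0.
  rewrite -integral_itv_obnd_cbnd//; last first.
    apply: measurable_funTS; apply/measurable_EFinP; apply: measurable_funM => //.
    by apply: measurable_funD => //; exact: measurable_funM.
  apply: eq_integral => s; rewrite inE/= in_itv/= andbT => sa.
  have cs : L < y + c * s by rewrite -yca ltrD2l ltr_pM2l.
  have s0 : 0 <= s := le_trans a0 (ltW sa).
  rewrite /up_step (ger0_norm s0) (min_r (ltW sa)).
  by rewrite (leNgt _ L) cs andbF addr0 mul0r addr0.
rewrite /A /B {A B}.
rewrite -EFinD; congr _%:E; rewrite /quad_primitive mulr0 expR0.
set e := expR _.
rewrite /mean_up /mean_horizontal /a; field.
by rewrite !gt_eqF.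
Qed.

End one_step_means.

(** * Sample paths *)

Section paths.
Context d (Omega : measurableType d) (R : realType) (P : probability Omega R).
Variables (lambda : R) (M : orthogonal_motion P lambda) (c L y : R).
Hypotheses (c_gt0 : 0 < c).

Definition vertical_speed (j : 'Z_4) : R :=
  if j == 1 then 1 else if j == 3 then -1 else 0.

Lemma Z4_cases (j : 'Z_4) : [\/ j = 0, j = 1, j = 2 | j = 3].
Proof.
by case: j => -[|[|[|[|//]]]] p;
  [apply: Or41|apply: Or42|apply: Or43|apply: Or44]; exact/val_inj.
Qed.

Lemma dir_vec_vertical (j : 'Z_4) : (dir_vec R j).2 = vertical_speed j.
Proof.
rewrite /dir_vec /vertical_speed /=; case: (Z4_cases j) => ->.
- by rewrite mulr0 mul0r sin0.
- by rewrite mulr1 sin_pihalf.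
- by rewrite (_ : nat_of_ord _ = 2%N)// mulfK// sinpi.
- rewrite (_ : nat_of_ord _ = 3%N)//.
  have -> : pi * 3%:R / 2 = pi / 2 + pi :> R by field.
  by rewrite sinDpi sin_pihalf.
Qed.

(** The height of the unstopped particle at the [n]-th event. *)
Fixpoint height (n : nat) (w : Omega) : R :=
  if n is m.+1
  then height m w + c * (waiting M m w * vertical_speed (dir_after M m w))
  else y.

(** Since the path is affine between events, being in the strip at the
    first [n] events means not having left it up to the [n]-th one. *)
Fixpoint inside (n : nat) (w : Omega) : bool :=
  if n is m.+1 then inside m w && (0 <= height m.+1 w <= L) else true.

Lemma insideS n w :
  inside n.+1 w = inside n w && (0 <= height n.+1 w <= L).
Proof. by []. Qed.

(** For a vertical direction, the waiting time is cut at the time needed to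
    reach the boundary. The absolute value only makes the function
    nonnegative everywhere: waiting times are almost surely positive. *)
Definition stay (n : nat) (w : Omega) : R :=
  if inside n w then
    if dir_after M n w == 1 then Num.min `|waiting M n w| ((L - height n w) / c)
    else if dir_after M n w == 3 then Num.min `|waiting M n w| (height n w / c)
    else `|waiting M n w|
  else 0.

Lemma inside_height n w : 0 <= y <= L -> inside n w -> 0 <= height n w <= L.
Proof. by move=> yL; case: n => [//|n] /= /andP[]. Qed.

Lemma inside_le m n w : (m <= n)%N -> inside n w -> inside m w.
Proof.
by move=> /subnK <-; elim: (n - m)%N => [//|k IH]; rewrite addSn => /= /andP[/IH].
Qed.

Lemma stay_ge0 n w : 0 <= y <= L -> 0 <= stay n w.
Proof.
move=> yL; rewrite /stay; case: ifP => // /(inside_height yL) /andP[h0 hL].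
case: ifP => _; last case: ifP => _ //;
  by rewrite le_min normr_ge0 divr_ge0 ?subr_ge0// ltW.
Qed.

Section path.
Variable w : Omega.
Hypotheses (y_strip : 0 <= y <= L) (waiting_gt0 : forall k, 0 < waiting M k w).
Local Notation mu := (@lebesgue_measure R).

Definition jump_time (n : nat) : R := \sum_(k < n) waiting M k w.

Lemma jump_timeS n : jump_time n.+1 = jump_time n + waiting M n w.
Proof. by rewrite /jump_time big_ord_recr. Qed.

Lemma jump_time_le m n : (m <= n)%N -> jump_time m <= jump_time n.
Proof.
move=> /subnK <-; elim: (n - m)%N => [//|k IH].
by rewrite addSn jump_timeS (le_trans IH)// lerDl ltW.
Qed.

Lemma jump_time_ge0 n : 0 <= jump_time n.
Proof. by have := jump_time_le (leq0n n); rewrite /jump_time big_ord0. Qed.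

(** Positive waiting times make the event times increasing, so that the
    events up to time [s] are exactly the first [n] ones. *)
Lemma poisson_count_between n s : jump_time n <= s < jump_time n.+1 ->
  poisson_count M s w = n.
Proof.
move=> /andP[ns sn]; rewrite /poisson_count.
have -> : [set k | event_time M k w <= s] = `I_n.
  apply/seteqP; split => k /=; rewrite -/(jump_time k.+1) => h.
    rewrite ltnNge; apply/negP => nk.
    have : jump_time k.+1 < jump_time n.+1 by exact: le_lt_trans sn.
    by rewrite ltNge jump_time_le.
  by rewrite (le_trans _ ns)// jump_time_le.
rewrite fset_set_II card_imfset/=; last exact: val_inj.
by rewrite size_enum_ord.
Qed.

Lemma height_sum n :
  height n w = y + c * \sum_(k < n) waiting M k w * vertical_speed (dir_after M k w).
Proof.
elim: n => [|n IH] /=; first by rewrite big_ord0 mulr0 addr0.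
by rewrite big_ord_recr/= IH mulrDr addrA.
Qed.

(** Half-open intervals are used because the direction is constant on
    `[jump_time k, jump_time k.+1[ and changes at the right end. *)
Lemma integral_vertical n t : jump_time n <= t <= jump_time n.+1 ->
  let f s := (dir_vec R (direction M s w)).2 in
  mu.-integrable `[0, t[ (EFin \o f) /\
  \int[mu]_(s in `[0, t[) f s =
    \sum_(k < n) waiting M k w * vertical_speed (dir_after M k w)
    + (t - jump_time n) * vertical_speed (dir_after M n w).
Proof.
move=> nt f.
have piece k u : jump_time k <= u <= jump_time k.+1 ->
    mu.-integrable `[0, jump_time k[ (EFin \o f) ->
    mu.-integrable `[0, u[ (EFin \o f) /\
    \int[mu]_(s in `[0, u[) f s = \int[mu]_(s in `[0, jump_time k[) f s
      + (u - jump_time k) * vertical_speed (dir_after M k w).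
  move=> /andP[ku uk] ik.
  have fE s : s \in `[jump_time k, u[%classic ->
      vertical_speed (dir_after M k w) = f s.
    rewrite inE/= in_itv/= => /andP[ks su].
    rewrite /f dir_vec_vertical /direction (@poisson_count_between k)//.
    by rewrite ks/= (lt_le_trans su).
  have iu : mu.-integrable `[jump_time k, u[ (EFin \o f).
    apply: (@eq_integrable _ _ _ mu _ _
        (EFin \o cst (vertical_speed (dir_after M k w)))) => //.
      by move=> s /fE /= ->.
    apply/integrableP; split; first by apply/measurable_EFinP.
    rewrite /comp /= integral_cst//= lebesgue_measure_itv/=.
    by case: ifP => _; rewrite -?EFinD -?EFinM ?mule0 ltry.
  have dis : [disjoint `[0, jump_time k[%classic & `[jump_time k, u[%classic].
    rewrite disj_set2E; apply/eqP/seteqP; split => // s /=.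
    rewrite !in_itv/= => -[/andP[_ sk] /andP[ks _]].
    by move: (lt_le_trans sk ks); rewrite ltxx.
  have split_u : `[0, u[%classic = `[0, jump_time k[ `|` `[jump_time k, u[ :> set R.
    by rewrite -itv_bndbnd_setU// bnd_simp ?jump_time_ge0.
  have iU : mu.-integrable `[0, u[ (EFin \o f).
    by rewrite split_u; exact: integrable_setU.
  split => //.
  rewrite [in LHS]split_u Rintegral_setU -?split_u//; congr (_ + _).
  have -> : \int[mu]_(s in `[jump_time k, u[) f s =
      \int[mu]_(s in `[jump_time k, u[) vertical_speed (dir_after M k w).
    by apply: eq_Rintegral => s /fE.
  rewrite Rintegral_cst//= lebesgue_measure_itv/= lte_fin mulrC.
  move: ku; rewrite le_eqVlt => /predU1P[<-|ku]; first by rewrite ltxx subrr.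
  by rewrite ku.
have full k : mu.-integrable `[0, jump_time k[ (EFin \o f) /\
    \int[mu]_(s in `[0, jump_time k[) f s =
      \sum_(i < k) waiting M i w * vertical_speed (dir_after M i w).
  elim: k => [|k [IH1 IH2]].
    rewrite /jump_time !big_ord0 set_itvco0 Rintegral_set0.
    by split => //; exact: integrable_set0.
  have [|i1 ->] := piece k (jump_time k.+1) _ IH1.
    by rewrite lexx jump_time_le.
  by split => //; rewrite IH2 big_ord_recr/= jump_timeS addrAC subrr add0r.
have [i1 i2] := full n.
by have [? ->] := piece n t nt i1; rewrite i2.
Qed.

Lemma position_between x n t : jump_time n <= t <= jump_time n.+1 ->
  (position M c x y t w).2 =
  height n w + c * ((t - jump_time n) * vertical_speed (dir_after M n w)).
Proof.
move=> /integral_vertical /= [int intE].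
by rewrite /position /= -Rintegral_itv_bndo_bndc// intE mulrDr addrA height_sum.
Qed.

(** An affine motion between two points of the strip stays in the strip. *)
Lemma inside_before x n t : inside n w -> 0 <= t <= jump_time n ->
  0 <= (position M c x y t w).2 <= L.
Proof.
elim: n => [_|n IH insS] /andP[t0 tn].
  have t00 : jump_time 0 <= t <= jump_time 1.
    rewrite {1}/jump_time big_ord0 t0 /= (le_trans tn)// jump_time_le//.
  rewrite (position_between x t00) /=.
  move: tn; rewrite /jump_time big_ord0 => tn.
  have -> : t = 0 by apply/eqP; rewrite eq_le tn t0.
  by rewrite subrr mul0r mulr0 addr0.
have /andP[ins hS] := insS.
have [tn'|nt] := leP t (jump_time n); first by apply: IH; rewrite // t0 tn'.
have ntn : jump_time n <= t <= jump_time n.+1 by rewrite ltW.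
rewrite (position_between x ntn).
have hn := inside_height y_strip ins.
have p0 : 0 <= c * (t - jump_time n) by rewrite mulr_ge0 ?subr_ge0 ?ltW.
have pQ : c * (t - jump_time n) <= c * waiting M n w.
  by rewrite ler_pM2l// lerBlDl -jump_timeS.
move: hS hn; rewrite [height n.+1 w]/= !mulrA; move: (c * _) (c * _) p0 pQ => p Q.
rewrite /vertical_speed; case: ifP => _; [|case: ifP => _]; lra.
Qed.

(** The time needed to reach the boundary from the [n]-th event on; only
    meaningful for a vertical direction. *)
Definition boundary_delay (n : nat) : R :=
  if dir_after M n w == 1 then (L - height n w) / c else height n w / c.

(** If the particle leaves between two consecutive events, then it moves
    vertically there, and it is in the strip exactly up to [boundary_delay]. *)
Lemma exit_step n : inside n w -> ~~ inside n.+1 w ->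
  [/\ vertical_speed (dir_after M n w) != 0, 0 <= boundary_delay n,
      boundary_delay n < waiting M n w &
   forall u, 0 <= u ->
     (0 <= height n w + c * (u * vertical_speed (dir_after M n w)) <= L) =
     (u <= boundary_delay n)].
Proof.
move=> ins outs.
have /andP[h0 hL] := inside_height y_strip ins.
have hS : ~~ (0 <= height n w +
    c * (waiting M n w * vertical_speed (dir_after M n w)) <= L).
  by move: outs; rewrite /= ins.
have W0 := waiting_gt0 n.
have v0 : vertical_speed (dir_after M n w) != 0.
  by apply: contraNneq hS => ->; rewrite !mulr0 addr0 h0.
have uE u : 0 <= u ->
    (0 <= height n w + c * (u * vertical_speed (dir_after M n w)) <= L) =
    (u <= boundary_delay n).
  move=> u0; move: v0; rewrite /vertical_speed /boundary_delay.
  have cu0 : 0 <= c * u by rewrite mulr_ge0// ltW.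
  case: ifP => [_ _|_]; last case: ifP => [_ _|_]; last by rewrite eqxx.
  - by rewrite ler_pdivlMr// mulr1 (mulrC u c); apply/idP/idP; lra.
  - by rewrite ler_pdivlMr// mulrN1 mulrN (mulrC u c); apply/idP/idP; lra.
split => //.
- by rewrite -uE// mul0r mulr0 addr0 h0.
- by rewrite ltNge -uE// ltW.
Qed.

Lemma exit_timeE x n : inside n w -> ~~ inside n.+1 w ->
  exit_time M c L x y w = (jump_time n + boundary_delay n)%:E :> \bar R.
Proof.
move=> ins outs; have [v0 r0 rW rE] := exit_step ins outs.
set r := boundary_delay n in r0 rW rE *.
apply/eqP; rewrite eq_le; apply/andP; split.
  apply/lee_addgt0Pr => e e0.
  (* A time slightly after the hitting time of the boundary, but before the
     next event. *)
  pose u := Num.min (r + e) (waiting M n w).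
  have ru : r < u by rewrite lt_min rW ltrDl e0.
  have uW : u <= waiting M n w by rewrite ge_min lexx orbT.
  have u0 : 0 < u by exact: le_lt_trans ru.
  apply: (@le_trans _ _ (jump_time n + u)%:E).
    apply: ereal_inf_lbound; exists (jump_time n + u) => //; split.
      by rewrite ltr_wpDl// jump_time_ge0.
    rewrite /strip /=.
    have nu : jump_time n <= jump_time n + u <= jump_time n.+1.
      by rewrite lerDl ltW//= jump_timeS lerD2l.
    have := position_between x nu; rewrite /= => ->.
    rewrite (addrAC (jump_time n)) subrr add0r rE; last exact: ltW.
    by apply/negP; rewrite -ltNge.
  by rewrite -EFinD lee_fin -addrA lerD2l ge_min lexx.
apply: le_ereal_inf_tmp => _ [t [t0 tout] <-]; rewrite lee_fin leNgt; apply/negP => tr.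
apply: tout; rewrite /strip.
have [tn|nt] := leP t (jump_time n).
  by apply: (inside_before x ins); rewrite tn ltW.
have ntn : jump_time n <= t <= jump_time n.+1.
  by rewrite ltW//= jump_timeS (le_trans (ltW tr))// lerD2l ltW.
have := position_between x ntn; rewrite /= => ->.
by rewrite rE ?subr_ge0; [rewrite lerBlDl ltW|exact: ltW].
Qed.

Lemma stay_before n : inside n.+1 w -> stay n w = waiting M n w.
Proof.
rewrite insideS => /andP[ins hS]; rewrite /stay ins gtr0_norm//.
move: hS; rewrite /= /vertical_speed; case: ifP => _ hS.
  rewrite min_l// ler_pdivlMr// mulrC; lra.
case: ifP hS => _ hS //.
rewrite min_l// ler_pdivlMr// mulrC; lra.
Qed.

Lemma stay_exit n : inside n w -> ~~ inside n.+1 w -> stay n w = boundary_delay n.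
Proof.
move=> ins outs; have [v0 r0 rW rE] := exit_step ins outs.
rewrite /stay ins gtr0_norm//; move: v0 rW.
rewrite /vertical_speed /boundary_delay; case: ifP => [_ _|_].
  by move=> /ltW; exact: min_r.
case: ifP => [_ _|_]; last by rewrite eqxx.
by move=> /ltW; exact: min_r.
Qed.

Lemma exit_time_sum_stay x n : inside n w -> ~~ inside n.+1 w ->
  (exit_time M c L x y w = \sum_(k <oo) (stay k w)%:E)%E.
Proof.
move=> ins outs; rewrite (exit_timeE x ins outs).
rewrite (nneseries_split 0 n.+1); last by move=> k _; rewrite lee_fin stay_ge0.
rewrite add0n [X in (_ + X)%E]eseries0 ?adde0; last first.
  move=> k nk _; rewrite /stay ifN//.
  by apply: contra outs => /(inside_le nk).
rewrite sumEFin big_mkord big_ord_recr /= stay_exit//; congr (_ + _)%:E.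
rewrite /jump_time; apply: eq_bigr => k _; rewrite stay_before//.
exact: inside_le ins.
Qed.

(** In a time greater than L/c a vertical motion crosses the whole strip. *)
Lemma long_wait_exits k : vertical_speed (dir_after M k w) != 0 ->
  L / c < waiting M k w -> ~~ inside k.+1 w.
Proof.
move=> v0 LW; apply/negP; rewrite insideS => /andP[ink hS].
have /andP[h0 hL] := inside_height y_strip ink.
move: hS v0; rewrite /= /vertical_speed.
move: LW; rewrite ltr_pdivrMr// mulrC => LW.
by case: ifP => [_|_]; last case: ifP => [_|]; rewrite ?eqxx//; lra.
Qed.

Lemma exists_exit_step k : vertical_speed (dir_after M k w) != 0 ->
  L / c < waiting M k w -> exists n, inside n w /\ ~~ inside n.+1 w.
Proof.
move=> v0 LW; have outk := long_wait_exits v0 LW.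
have ex : exists m, ~~ inside m w by exists k.+1.
case: (ex_minnP ex) => -[//|n] outn minn; exists n; split => //.
by apply: contraT => /minn; rewrite ltnn.
Qed.

End path.

End paths.

(** * The sigma-algebra of the past *)

Section filtration.
Context d (Omega : measurableType d) (R : realType) (P : probability Omega R).
Variables (lambda : R) (M : orthogonal_motion P lambda) (c L y : R).

Local Notation source := (source_sigma (init_dir M) (waiting M) (turn M)).

Lemma source_setI i : setI_closed (source i).
Proof.
case: i => [[n|n]|] A B /= [A' mA <-] [B' mB <-]; exists (A' `&` B');
  rewrite ?setTI ?preimage_setI//; exact: measurableI.
Qed.

Lemma source_setT i : source i setT.
Proof.
by case: i => [[n|n]|] /=; exists setT; rewrite ?setTI ?preimage_setT.
Qed.

Lemma init_dir_measurable_preimage (B : set 'Z_4) :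
  measurable (init_dir M @^-1` B).
Proof.
have -> : init_dir M @^-1` B = \bigcup_(j in B) init_dir M @^-1` [set j].
  apply/seteqP; split => [w Bw|w [j Bj /= wj]]; last by rewrite /= wj.
  by exists (init_dir M w) => //; exact: Bw.
apply: fin_bigcup_measurable => [|j _]; first exact: finite_finset.
exact: init_dir_measurable.
Qed.

Lemma source_measurable i : source i `<=` measurable.
Proof.
case: i => [[n|n]|] A /= [B mB <-]; rewrite setTI.
- by rewrite -[X in measurable X]setTI; exact: (measurable_funPT (waiting M n)).
- by rewrite -[X in measurable X]setTI; exact: (measurable_funPT (turn M n)).
- exact: init_dir_measurable_preimage.
Qed.

(** The sources that determine the height and the direction right after the
    [n]-th event: the initial direction and the first [n] waiting times and
    turns. *)
Definition past (n : nat) (i : option (nat + nat)) : Prop :=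
  match i with
  | None => True
  | Some (inl k) | Some (inr k) => (k < n)%N
  end.

Definition history (n : nat) : set (set Omega) := cylinders source (past n).

Local Notation hist n := (g_sigma_algebraType (history n)).

Lemma history_measurable n : history n `<=` measurable.
Proof. exact: (cylinders_measurable source_measurable). Qed.

(** This is what the independence of the sources is used for: the [n]-th
    waiting time and the [n]-th turn are independent of the first [n] steps. *)
Lemma history_independent n i A E : ~ past n i -> <<s history n >> A ->
  source i E -> P (A `&` E) = (P A * P E)%E.
Proof.
exact: (independent_sigma_algebra (@source_setI) (@source_setT)
  (@source_measurable) (@motion_independent _ _ _ _ _ M)).
Qed.

Lemma sub_history n i E : past n i -> source i E -> <<s history n >> E.
Proof.
move=> ni sE; apply: sub_sigma_algebra.
exact: (sub_cylinders source_setT ni).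
Qed.

Lemma history_waiting n k : (k < n)%N ->
  measurable_fun [set: hist n] (waiting M k : hist n -> R).
Proof.
move=> kn _ B mB; apply: (@sub_history n (Some (inl k))) => //.
by exists B.
Qed.

Lemma history_turn n k : (k < n)%N ->
  measurable_fun [set: hist n] (turn M k : hist n -> bool).
Proof.
move=> kn _ B mB; apply: (@sub_history n (Some (inr k))) => //.
by exists B.
Qed.

Lemma history_init n j : @measurable _ (hist n) (init_dir M @^-1` [set j]).
Proof. by apply: (@sub_history n None) => //; exists [set j]; rewrite ?setTI. Qed.

Lemma history_dir n k j : (k <= n)%N ->
  measurable_fun [set: hist n] (fun w : hist n => dir_after M k w == j).
Proof.
elim: k j => [|k IH] j kn.
  apply: (measurable_fun_bool true); rewrite setTI.
  rewrite (_ : _ @^-1` _ = init_dir M @^-1` [set j]); first exact: history_init.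
  by apply/seteqP; split => w /= /eqP.
rewrite (_ : (fun w => _) = (fun w => if turn M k w then dir_after M k w == j - 1
    else dir_after M k w == j + 1)); last first.
  apply/funext => w /=; case: (turn M k w).
    by rewrite -(inj_eq (addIr (-1))) addrK.
  by rewrite -(inj_eq (addIr 1)) subrK.
apply: measurable_fun_ifT; first exact: history_turn.
  exact: IH (ltnW kn).
exact: IH (ltnW kn).
Qed.

Lemma history_height n k : (k <= n)%N ->
  measurable_fun [set: hist n] (height M c y k : hist n -> R).
Proof.
elim: k => [|k IH] kn; first exact: measurable_cst.
rewrite /height -/(height M c y k); apply: measurable_funD; first exact: IH (ltnW kn).
apply: measurable_funM => //; apply: measurable_funM; first exact: history_waiting.
rewrite /vertical_speed.
apply: measurable_fun_ifT => //; first exact: history_dir (ltnW kn).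
by apply: measurable_fun_ifT => //; exact: history_dir (ltnW kn).
Qed.

Lemma measurable_strip : measurable_fun [set: R] (fun h : R => 0 <= h <= L).
Proof. by apply: measurable_and; exact: measurable_fun_ler. Qed.

Lemma history_inside n k : (k <= n)%N ->
  measurable_fun [set: hist n] (inside M c L y k : hist n -> bool).
Proof.
elim: k => [|k IH] kn; first exact: measurable_cst.
rewrite (_ : inside M c L y k.+1 = fun w =>
    inside M c L y k w && (0 <= height M c y k.+1 w <= L))//.
apply: measurable_and; first exact: IH (ltnW kn).
exact: (measurableT_comp measurable_strip (history_height kn)).
Qed.

Lemma history_stay n k : (k < n)%N ->
  measurable_fun [set: hist n] (stay M c L y k : hist n -> R).
Proof.
move=> kn; rewrite /stay.
have mW : measurable_fun [set: hist n] (fun w : hist n => `|waiting M k w|).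
  by apply: measurableT_comp => //; exact: history_waiting.
have mH := history_height (ltnW kn).
apply: measurable_fun_ifT => //; first exact: history_inside (ltnW kn).
apply: measurable_fun_ifT => //; first exact: history_dir (ltnW kn).
  apply: measurable_minr => //; apply: measurable_funM => //.
  exact: measurable_funB.
apply: measurable_fun_ifT => //; first exact: history_dir (ltnW kn).
by apply: measurable_minr => //; exact: measurable_funM.
Qed.

Definition mean_dir (j : 'Z_4) (h : R) : R :=
  if j == 1 then mean_up lambda c L h
  else if j == 3 then mean_down lambda c L h
  else mean_horizontal lambda c L h.

Lemma measurable_mean_dir j : measurable_fun setT (mean_dir j).
Proof.
rewrite /mean_dir; case: (j == 1); last case: (j == 3).
- exact: measurable_mean_up.
- exact: measurable_mean_down.
- exact: measurable_mean_horizontal.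
Qed.

(** The mean of the time left at the [n]-th event, if the candidates are
    right. *)
Definition remaining (n : nat) (w : Omega) : R :=
  if inside M c L y n w then mean_dir (dir_after M n w) (height M c y n w) else 0.

Lemma history_remaining n k : (k <= n)%N ->
  measurable_fun [set: hist n] (remaining k : hist n -> R).
Proof.
move=> kn; rewrite /remaining.
apply: measurable_fun_ifT => //; first exact: history_inside.
have mH := history_height kn.
rewrite /mean_dir.
apply: measurable_fun_ifT => //; first exact: history_dir.
  exact: (measurableT_comp (measurable_mean_up lambda c L)).
apply: measurable_fun_ifT => //; first exact: history_dir.
  exact: (measurableT_comp (measurable_mean_down lambda c L)).
exact: (measurableT_comp (measurable_mean_horizontal lambda c L)).
Qed.

Lemma measurable_stay n : measurable_fun setT (stay M c L y n).
Proof.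
apply: (measurable_fun_sub_sigma (@history_measurable n.+1)).
exact: history_stay.
Qed.

Lemma measurable_remaining n : measurable_fun setT (remaining n).
Proof.
apply: (measurable_fun_sub_sigma (@history_measurable n)).
exact: history_remaining.
Qed.

End filtration.

(** * The one-step equation *)

Section one_step.
Context d (Omega : measurableType d) (R : realType) (P : probability Omega R).
Variables (lambda : R) (M : orthogonal_motion P lambda) (c L y : R).
Hypotheses (lambda_gt0 : 0 < lambda) (c_gt0 : 0 < c) (L_gt0 : 0 < L).
Hypothesis y_strip : 0 <= y <= L.
Local Notation mu := (@lebesgue_measure R).
Local Notation height := (height M c y).
Local Notation inside := (inside M c L y).
Local Notation stay := (stay M c L y).
Local Notation remaining := (remaining M c L y).
Local Notation up_step := (up_step lambda c L).
Local Notation mean_up := (mean_up lambda c L).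
Local Notation mean_down := (mean_down lambda c L).
Local Notation mean_horizontal := (mean_horizontal lambda c L).

Lemma integral_waiting n (f : R -> \bar R) : measurable_fun setT f ->
  (forall s, 0 <= f s)%E ->
  (\int[distribution P (waiting M n)]_s f s =
   \int[mu]_(s in `[0%R, +oo[) (f s * (lambda * expR (- lambda * s))%:E))%E.
Proof.
move=> mf f0.
(* Lebesgue measure lives on another, convertible, measurable structure on R:
   the law of the waiting time is transported there. *)
pose T : measurableType _ := measurableTypeR R.
have mW : @measurable_fun _ _ Omega T setT (waiting M n).
  exact: (measurable_funPT (waiting M n)).
pose W : {RV P >-> T} := @mfun_Sub _ _ Omega T _ (mem_set mW).
transitivity (\int[distribution P W]_s f s)%E.
  rewrite ge0_integral_distribution//.
  by rewrite (@ge0_integral_distribution _ _ _ T _ _ W).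
rewrite (@ge0_integral_density _ T R (distribution P W) mu
  (exponential_pdf lambda))//; last 3 first.
- by move=> s; apply: exponential_pdf_ge0; exact: ltW.
- exact: measurable_exponential_pdf.
- by move=> A mA; exact: (waiting_exponential M n mA).
rewrite [RHS]integral_mkcond; apply: eq_integral => s _.
rewrite patchE /exponential_pdf patchE; case: ifP => //; by rewrite mule0.
Qed.

Lemma integral_waiting_norm n :
  (\int[distribution P (waiting M n)]_s `|s|%:E = (lambda^-1)%:E)%E.
Proof.
rewrite integral_waiting//; last first.
  by apply/measurable_EFinP; exact: normr_measurable.
transitivity (\int[mu]_(s in `[0%R, +oo[)
    ((0 + 1 * s) * (lambda * expR (- lambda * s)))%:E)%E.
  apply: eq_integral => s; rewrite inE/= in_itv/= andbT => s0.
  by rewrite -EFinM ger0_norm// add0r mul1r.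
rewrite integral_linear_exp_y//; last by move=> s s0; rewrite add0r mul1r.
by rewrite /quad_primitive mulr0 expR0; congr _%:E; field; rewrite gt_eqF.
Qed.

Lemma integral_waiting_up_step n h : 0 <= h <= L ->
  (\int[distribution P (waiting M n)]_s `|up_step h s|%:E = (mean_up h)%:E)%E.
Proof.
move=> hL; rewrite integral_waiting//; last first.
  apply/measurable_EFinP; apply: measurableT_comp => //.
  exact: (measurable_fun_pair2 h (measurable_up_step lambda c L)).
rewrite -(integral_up_step lambda_gt0 c_gt0)//.
apply: eq_integral => s _; rewrite -EFinM ger0_norm// up_step_ge0//.
by case/andP: hL.
Qed.

Lemma history_indep_waiting n A B : <<s history M n >> A -> measurable B ->
  (P (A `&` waiting M n @^-1` B) = P A * P (waiting M n @^-1` B))%E.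
Proof.
move=> hA mB; apply: (@history_independent _ _ _ _ _ M n (Some (inl n))) => //.
  by rewrite /= ltnn.
by exists B; rewrite ?setTI.
Qed.

Lemma history_indep_turn n A B : <<s history M n >> A -> measurable B ->
  (P (A `&` turn M n @^-1` B) = P A * P (turn M n @^-1` B))%E.
Proof.
move=> hA mB; apply: (@history_independent _ _ _ _ _ M n (Some (inr n))) => //.
  by rewrite /= ltnn.
by exists B; rewrite ?setTI.
Qed.

Lemma integral_turn n (f : bool -> \bar R) : (forall b, 0 <= f b)%E ->
  (\int[distribution P (turn M n)]_b f b = (2^-1)%:E * f true + (2^-1)%:E * f false)%E.
Proof.
move=> f0.
have -> : [set: bool] = [set true] `|` [set false].
  by apply/seteqP; split => -[] //= _; [left|right].
have single b :
    (\int[distribution P (turn M n)]_(x in [set b]) f x = (2^-1)%:E * f b)%E.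
  transitivity (\int[distribution P (turn M n)]_(x in [set b]) f b)%E.
    by apply: eq_integral => x /set_mem /= ->.
  rewrite integral_cst// muleC; congr (_ * _)%E.
  exact: turn_fair.
rewrite ge0_integral_setU//; last first.
  by rewrite disj_set2E; apply/eqP/seteqP; split => // b [/= -> ].
by rewrite !single.
Qed.

(** Fixing the state at the [n]-th event turns the one-step equation into an
    identity between functions of the height, the next waiting time and the
    next turn. *)
Definition state_event (j : 'Z_4) (n : nat) (i : 'Z_4) : set Omega :=
  init_dir M @^-1` [set j] `&` [set w | inside n w /\ dir_after M n w = i].

Lemma history_state_event j n i : <<s history M n >> (state_event j n i).
Proof.
apply: (@measurableI _ (g_sigma_algebraType (history M n))).
  exact: history_init.
have := @measurable_and _ (g_sigma_algebraType (history M n)) setT _ _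
  (history_inside (M := M) c L y (leqnn n)) (history_dir (M := M) i (leqnn n)).
move=> /(_ measurableT [set true] Logic.I); rewrite setTI.
congr (<<s _ >> _); apply/seteqP; split => w /=.
  by move=> /andP[-> /eqP].
by move=> [-> ->]; rewrite eqxx.
Qed.

Lemma measurable_state_event j n i : measurable (state_event j n i).
Proof.
apply: (smallest_sub (@sigma_algebra_measurable _ Omega)
  (@history_measurable _ _ _ _ _ M n)).
exact: history_state_event.
Qed.


Lemma mean_dir_ge0 i h : 0 <= h <= L -> 0 <= mean_dir lambda c L i h.
Proof.
move=> hL; rewrite /mean_dir; case: ifP => _; last case: ifP => _.
- exact: mean_up_ge0.
- exact: mean_down_ge0.
- exact: mean_horizontal_ge0.
Qed.

Lemma remaining_ge0 n w : 0 <= remaining n w.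
Proof.
rewrite /remaining; case: ifP => // /(inside_height y_strip).
exact: mean_dir_ge0.
Qed.

Lemma integral_state_events j n (f : Omega -> \bar R) :
  measurable_fun setT f -> (forall w, 0 <= f w)%E ->
  (forall w, ~~ inside n w -> f w = 0%E) ->
  (\int[P]_(w in init_dir M @^-1` [set j]) f w =
   \sum_(i : 'Z_4) \int[P]_(w in state_event j n i) f w)%E.
Proof.
move=> mf f0 fout.
rewrite -ge0_integral_bigsetU//; first last.
- exact: measurable_funTS.
- move=> i k _ _ [w [[_ [_ <-]] [_ [_ <-]]]] //.
- exact: index_enum_uniq.
- by move=> i; exact: measurable_state_event.
rewrite [LHS]integral_mkcond [RHS]integral_mkcond; apply: eq_integral => w _.
rewrite !patchE; case: ifPn => [/set_mem jw|jw].
  case: ifPn => // wU; apply: fout; apply: contraNN wU => ins.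
  rewrite inE -bigcup_seq; exists (dir_after M n w) => //=.
  by rewrite mem_index_enum.
rewrite ifN//; apply: contraNN jw; rewrite !inE -bigcup_seq.
by move=> [i _ [//]].
Qed.

(** After a vertical phase the particle moves horizontally, and both
    horizontal directions have the same mean, so that integrating out the
    waiting time is enough. *)
Lemma step_up j n :
  (\int[P]_(w in state_event j n 1%R) (stay n w + remaining n.+1 w)%:E =
   \int[P]_(w in state_event j n 1%R) (remaining n w)%:E)%E.
Proof.
pose f (z : R * R) := `|up_step z.1 z.2|%:E.
have mf : measurable_fun setT f.
  apply/measurable_EFinP; apply: measurableT_comp => //.
  exact: measurable_up_step.
transitivity (\int[P]_(w in state_event j n 1%R) f (height n w, waiting M n w))%E.
  apply: eq_integral => w /set_mem [_ [ins dw]].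
  have hL := inside_height y_strip ins.
  rewrite /f /= ger0_norm ?up_step_ge0//; last by case/andP: hL.
  rewrite /stay ins dw eqxx /up_step; congr (_ + _)%:E.
  rewrite /remaining insideS ins /= dw /vertical_speed eqxx mulr1.
  case: ifP => // _; rewrite /mean_dir /=.
  by case: (turn M n w).
rewrite (integral_independent_on (@history_measurable _ _ _ _ _ M n)
  (@history_indep_waiting n))//; last 3 first.
- exact: history_state_event.
- exact: history_height.
- by move=> z; rewrite /f lee_fin.
apply: eq_integral => w /set_mem [_ [ins dw]].
rewrite integral_waiting_up_step ?inside_height//.
by rewrite /remaining ins dw.
Qed.

(** The reflection h |-> L - h reduces the direction down to the direction
    up. *)
Lemma step_down j n :
  (\int[P]_(w in state_event j n 3%R) (stay n w + remaining n.+1 w)%:E =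
   \int[P]_(w in state_event j n 3%R) (remaining n w)%:E)%E.
Proof.
pose f (z : R * R) := `|up_step z.1 z.2|%:E.
have mf : measurable_fun setT f.
  apply/measurable_EFinP; apply: measurableT_comp => //.
  exact: measurable_up_step.
transitivity (\int[P]_(w in state_event j n 3%R)
    f ((L - height n w)%R, waiting M n w))%E.
  apply: eq_integral => w /set_mem [_ [ins dw]].
  have /andP[h0 hL] := inside_height y_strip ins.
  rewrite /f /= ger0_norm ?up_step_ge0//; last by rewrite lerBlDr lerDl.
  rewrite /stay ins dw /up_step; congr (_ + _)%:E; first by rewrite /= subKr.
  rewrite /remaining insideS ins /= dw /vertical_speed /= mulrN1.
  have hE : L - (height n w + c * - waiting M n w) = L - height n w + c * waiting M n w.
    by rewrite mulrN opprB addrCA addrC.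
  have -> : (0 <= height n w + c * - waiting M n w <= L) =
      (0 <= L - height n w + c * waiting M n w <= L).
    by apply/idP/idP; rewrite mulrN; lra.
  case: ifP => // _; rewrite -hE mean_horizontalC// /mean_dir.
  by case: (turn M n w).
rewrite (integral_independent_on (@history_measurable _ _ _ _ _ M n)
  (@history_indep_waiting n))//; last 3 first.
- exact: history_state_event.
- by apply: measurable_funB => //; exact: history_height.
- by move=> z; rewrite /f lee_fin.
apply: eq_integral => w /set_mem [_ [ins dw]].
have /andP[h0 hL] := inside_height y_strip ins.
rewrite integral_waiting_up_step ?subr_ge0 ?hL ?lerBlDr ?lerDl//.
by rewrite /remaining ins dw mean_upC.
Qed.

(** The height does not change, the mean waiting time is 1/lambda, and the
    turn leads to the means of the directions up and down with probability
    1/2 each. *)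
Lemma step_horizontal j n i : i = 0 \/ i = 2 ->
  (\int[P]_(w in state_event j n i) (stay n w + remaining n.+1 w)%:E =
   \int[P]_(w in state_event j n i) (remaining n w)%:E)%E.
Proof.
move=> i02.
have v0 : vertical_speed R i = 0 by case: i02 => ->.
have [i1 i3] : (i == 1) = false /\ (i == 3) = false by case: i02 => ->.
have mU := measurable_state_event j n i.
pose g (z : R * bool) :=
  if z.2 then `|mean_dir lambda c L (i + 1) z.1|%:E
  else `|mean_dir lambda c L (i - 1) z.1|%:E.
have mg : measurable_fun setT g.
  apply: (@measurable_fun_if_pair _ _ R (\bar R)
    (fun h => `|mean_dir lambda c L (i + 1) h|%:E)
    (fun h => `|mean_dir lambda c L (i - 1) h|%:E));
  apply/measurable_EFinP; apply: measurableT_comp => //; exact: measurable_mean_dir.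
have g0 z : (0 <= g z)%E by rewrite /g; case: ifP => _; rewrite lee_fin.
have mW : measurable_fun setT (fun w => `|waiting M n w|%:E).
  by apply/measurable_EFinP; exact: measurableT_comp.
have mgw : measurable_fun setT (fun w => g (height n w, turn M n w)).
  apply: measurableT_comp => //; apply: measurable_fun_pair => //.
  apply: (measurable_fun_sub_sigma (@history_measurable _ _ _ _ _ M n)).
  exact: history_height.
transitivity (\int[P]_(w in state_event j n i)
    (`|waiting M n w|%:E + g (height n w, turn M n w)))%E.
  apply: eq_integral => w /set_mem [_ [ins dw]].
  have hL := inside_height y_strip ins.
  rewrite /stay ins dw i1 i3 EFinD; congr (_ + _)%E.
  rewrite /remaining insideS ins /= dw v0 !mulr0 addr0 hL /g /=.
  by case: (turn M n w); rewrite ger0_norm// mean_dir_ge0.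
rewrite ge0_integralD//; last first.
- exact: measurable_funTS.
- exact: measurable_funTS.
have iW : (\int[P]_(w in state_event j n i) `|waiting M n w|%:E =
    \int[P]_(w in state_event j n i) (lambda^-1)%:E)%E.
  (* The waiting time alone is integrated out: the state plays the part of X. *)
  rewrite (integral_independent_on (@history_measurable _ _ _ _ _ M n)
    (@history_indep_waiting n) (X := height n) (f := fun z => `|z.2|%:E)).
  - by apply: eq_integral => w _; rewrite integral_waiting_norm.
  - exact: history_state_event.
  - exact: history_height.
  - by apply/measurable_EFinP; exact: measurableT_comp.
  - by move=> z; rewrite lee_fin.
have ig : (\int[P]_(w in state_event j n i) g (height n w, turn M n w) =
    \int[P]_(w in state_event j n i)
      ((2^-1 * `|mean_dir lambda c L (i + 1) (height n w)| +
        2^-1 * `|mean_dir lambda c L (i - 1) (height n w)|)%R)%:E)%E.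
  rewrite (integral_independent_on (@history_measurable _ _ _ _ _ M n)
    (@history_indep_turn n))//.
  - by apply: eq_integral => w _; rewrite integral_turn.
  - exact: history_state_event.
  - exact: history_height.
have mH : measurable_fun setT (height n).
  apply: (measurable_fun_sub_sigma (@history_measurable _ _ _ _ _ M n)).
  exact: history_height.
have mm k : measurable_fun setT
    (fun w => 2^-1 * `|mean_dir lambda c L k (height n w)|).
  apply: measurable_funM => //; apply: measurableT_comp => //.
  exact: (measurableT_comp (measurable_mean_dir lambda c L k)).
rewrite iW ig -ge0_integralD//; last 2 first.
- by move=> w _; rewrite lee_fin invr_ge0 ltW.
- by apply/measurable_funTS/measurable_EFinP; exact: measurable_funD.
apply: eq_integral => w /set_mem [_ [ins dw]].
have hL := inside_height y_strip ins.
rewrite !ger0_norm ?mean_dir_ge0// /remaining ins dw -EFinD; congr _%:E.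
have mean_eq h :
    lambda^-1 + (2^-1 * mean_up h + 2^-1 * mean_down h) = mean_horizontal h.
  rewrite /mean_up /mean_down /mean_horizontal; field.
  by rewrite !gt_eqF.
rewrite [in RHS]/mean_dir i1 i3 -mean_eq; case: i02 => -> //.
by congr (_ + _); rewrite addrC.
Qed.

Lemma integral_step j n :
  (\int[P]_(w in init_dir M @^-1` [set j]) (stay n w)%:E +
   \int[P]_(w in init_dir M @^-1` [set j]) (remaining n.+1 w)%:E =
   \int[P]_(w in init_dir M @^-1` [set j]) (remaining n w)%:E)%E.
Proof.
have mA := init_dir_measurable_preimage M [set j].
have ms : measurable_fun setT (EFin \o stay n).
  by apply/measurable_EFinP; exact: measurable_stay.
have mr k : measurable_fun setT (EFin \o remaining k).
  by apply/measurable_EFinP; exact: measurable_remaining.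
rewrite -ge0_integralD//; last 4 first.
- by move=> w _; rewrite lee_fin stay_ge0.
- exact: measurable_funTS.
- by move=> w _; rewrite lee_fin remaining_ge0.
- exact/measurable_funTS/mr.
rewrite [LHS](integral_state_events (n := n) j); last 3 first.
- by apply: emeasurable_funD; [exact: ms|exact: mr].
- by move=> w; rewrite -EFinD lee_fin addr_ge0 ?stay_ge0 ?remaining_ge0.
- move=> w outs; rewrite /stay /remaining (negbTE outs) ifN ?adde0//.
  by rewrite insideS (negbTE outs).
rewrite [RHS](integral_state_events (n := n) j)//; last 3 first.
- exact: mr.
- by move=> w; rewrite lee_fin remaining_ge0.
- by move=> w outs; rewrite /remaining (negbTE outs).
apply: eq_bigr => i _.
case: (Z4_cases i) => ->.
- by apply: step_horizontal; left.
- exact: step_up.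
- by apply: step_horizontal; right.
- exact: step_down.
Qed.

End one_step.

(** * Almost sure exit *)

Section almost_sure_exit.
Context d (Omega : measurableType d) (R : realType) (P : probability Omega R).
Variables (lambda : R) (M : orthogonal_motion P lambda) (c L y : R).
Hypotheses (lambda_gt0 : 0 < lambda) (c_gt0 : 0 < c) (L_gt0 : 0 < L).
Hypothesis y_strip : 0 <= y <= L.
Local Notation inside := (inside M c L y).

(** The distribution function of the exponential law, at 0 included: a waiting
    time is almost surely positive. *)
Lemma waiting_le n a : 0 <= a ->
  P (waiting M n @^-1` `]-oo, a]) = (1 - expR (- lambda * a))%:E.
Proof.
move=> a0.
have gt : P (waiting M n @^-1` `]a, +oo[) = (expR (- lambda * a))%:E.
  transitivity (exponential_prob lambda `]a, +oo[); first exact: waiting_exponential.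
  rewrite /exponential_prob.
  transitivity (\int[lebesgue_measure]_(s in `]a, +oo[)
      ((1 + 0 * s) * (lambda * expR (- lambda * s)))%:E)%E.
    apply: eq_integral => s; rewrite inE/= in_itv/= andbT => sa.
    by rewrite exponential_pdfE ?(le_trans a0) ?ltW// mul0r addr0 mul1r.
  rewrite integral_itv_obnd_cbnd//; last first.
    apply: measurable_funTS; apply/measurable_EFinP; apply: measurable_funM.
      by apply: measurable_funD => //; exact: measurable_funM.
    by apply: measurable_funM => //; apply: measurableT_comp => //;
    exact: measurable_funM.
  rewrite integral_linear_exp_y//; last by move=> s _; rewrite mul0r addr0.
  by rewrite /quad_primitive; congr _%:E; field; rewrite gt_eqF.
have -> : waiting M n @^-1` `]-oo, a] = ~` (waiting M n @^-1` `]a, +oo[).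
  apply/seteqP; split => w /=; rewrite !in_itv/= andbT leNgt.
    by move=> /negP.
  by move=> /negP.
rewrite probability_setC; last first.
  by rewrite -[X in measurable X]setTI; exact: (measurable_funPT (waiting M n)).
by rewrite gt.
Qed.

(** Vertical and horizontal phases alternate, so that the vertical ones have
    the indices 2 k + e, where e is 0 or 1. *)
Definition short_waits (a : R) (e m : nat) : set Omega :=
  [set w | forall k, (k < m)%N -> waiting M (k.*2 + e) w <= a].

Lemma short_waitsS a e m : short_waits a e m.+1 =
  short_waits a e m `&` waiting M (m.*2 + e) @^-1` `]-oo, a].
Proof.
apply/seteqP; split => [w h|w [h1 h2] k] /=.
  by split => [k km|]; [exact: h (ltnW km)|rewrite in_itv /=; exact: h].
rewrite ltnS leq_eqVlt => /predU1P[->|/h1//].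
by move: h2; rewrite /= in_itv.
Qed.

Lemma history_short_waits a e m n : (m.*2 + e <= n.+1)%N ->
  <<s history M n >> (short_waits a e m).
Proof.
elim: m => [|m IH] mn.
  rewrite (_ : short_waits _ _ _ = setT).
    exact: (@measurableT _ (g_sigma_algebraType (history M n))).
  by apply/seteqP; split.
have kn : (m.*2 + e < n)%N by move: mn; rewrite doubleS !addSn ltnS.
rewrite short_waitsS.
apply: (@measurableI _ (g_sigma_algebraType (history M n))).
  by apply: IH; rewrite leqW// ltnW.
have := @history_waiting _ _ _ _ _ M n _ kn measurableT _ (measurable_itv `]-oo, a]).
by rewrite setTI.
Qed.

Lemma probability_short_waits a e m : 0 <= a ->
  P (short_waits a e m) = ((1 - expR (- lambda * a)) ^+ m)%:E.
Proof.
move=> a0; elim: m => [|m IH].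
  rewrite (_ : short_waits _ _ _ = setT) ?probability_setT//.
  by apply/seteqP; split.
rewrite short_waitsS history_indep_waiting//; last first.
  by apply: history_short_waits.
by rewrite IH waiting_le// -EFinM exprSr.
Qed.

Lemma measurable_short_waits a e m : measurable (short_waits a e m).
Proof.
apply: (smallest_sub (@sigma_algebra_measurable _ Omega)
  (@history_measurable _ _ _ _ _ M (m.*2 + e))).
exact: history_short_waits.
Qed.

(** The index of the first vertical phase: 0 for the odd directions, up and
    down, and 1 for the even ones. *)
Definition parity_offset (j : 'Z_4) : nat := ~~ odd j.

Lemma odd_dir_after n w : odd (dir_after M n w) = odd (init_dir M w) (+) odd n.
Proof.
elim: n => [|n IH] /=; first by rewrite addbF.
rewrite addbN -IH; case: (turn M n w); by case: (Z4_cases (dir_after M n w)) => ->.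
Qed.

Lemma vertical_dir (j : 'Z_4) : odd j -> vertical_speed R j != 0.
Proof.
by case: (Z4_cases j) => -> //= _; rewrite /vertical_speed /= ?oppr_eq0 oner_eq0.
Qed.

Lemma vertical_step k w :
  vertical_speed R (dir_after M (k.*2 + parity_offset (init_dir M w)) w) != 0.
Proof.
apply: vertical_dir; rewrite odd_dir_after oddD odd_double /=.
by rewrite /parity_offset; case: (odd (init_dir M w)).
Qed.

Lemma inside_short_waits m w : inside (m.*2.+1) w ->
  short_waits (L / c) (parity_offset (init_dir M w)) m w.
Proof.
move=> ins k km; rewrite leNgt; apply/negP => LW.
have im : ((k.*2 + parity_offset (init_dir M w)).+1 <= m.*2.+1)%N.
  rewrite ltnS (@leq_trans (k.*2 + 1))// ?leq_add2l ?leq_b1//.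
  by rewrite addn1 ltn_double.
have := inside_le im ins.
by rewrite (negbTE (long_wait_exits c_gt0 y_strip (vertical_step k w) LW)).
Qed.

Definition endless (e : nat) : set Omega :=
  [set w | forall k, waiting M (k.*2 + e) w <= L / c].

(** Outside this null set the waiting times are positive and, whatever the
    initial direction, some vertical phase is long enough to cross the
    strip. *)
Definition exceptional : set Omega :=
  (\bigcup_n waiting M n @^-1` `]-oo, 0]) `|` (endless 0 `|` endless 1).

Lemma endless_bigcap e : endless e = \bigcap_m short_waits (L / c) e m.
Proof.
apply/seteqP; split => w h; first by move=> m _ k _; exact: h.
by move=> k; apply: (h k.+1 Logic.I k).
Qed.

Lemma measurable_endless e : measurable (endless e).
Proof.
rewrite endless_bigcap; apply: bigcapT_measurable => m.
exact: measurable_short_waits.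
Qed.

Lemma short_ratio : 0 <= 1 - expR (- lambda * (L / c)) < 1.
Proof.
rewrite subr_ge0 expR_le1 gtrBl expR_gt0 andbT mulNr oppr_le0.
by rewrite mulr_ge0 ?ltW// divr_gt0.
Qed.

Lemma small_ratio_power (K e : R) : 0 < e ->
  exists m, K * (1 - expR (- lambda * (L / c))) ^+ m <= e.
Proof.
move=> e0; have /andP[q0 q1] := short_ratio.
have := @cvg_geometric R K (1 - expR (- lambda * (L / c))).
rewrite ger0_norm// => /(_ q1) /cvgrPdist_le /(_ e e0) [m _ /(_ m (leqnn m))].
by rewrite sub0r normrN => /(le_trans (ler_norm _)) Km; exists m.
Qed.

Lemma probability_endless e : P (endless e) = 0%E.
Proof.
apply/eqP; rewrite eq_le measure_ge0 andbT; apply/lee_addgt0Pr => r r0.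
have [m qm] := @small_ratio_power 1 r r0.
rewrite add0e (@le_trans _ _ (P (short_waits (L / c) e m)))//.
  apply: le_measure; rewrite ?inE.
  - exact: measurable_endless.
  - exact: measurable_short_waits.
  - by move=> w h k _; exact: h.
rewrite probability_short_waits; last by rewrite divr_ge0 ?ltW.
by rewrite lee_fin -[leLHS]mul1r.
Qed.

Lemma measurable_exceptional : measurable exceptional.
Proof.
apply: measurableU; last by apply: measurableU; exact: measurable_endless.
apply: bigcupT_measurable => n.
by rewrite -[X in measurable X]setTI; exact: (measurable_funPT (waiting M n)).
Qed.

Lemma probability_exceptional : P exceptional = 0%E.
Proof.
rewrite /exceptional.
have mn n : measurable (waiting M n @^-1` `]-oo, 0]).
  by rewrite -[X in measurable X]setTI; exact: (measurable_funPT (waiting M n)).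
have me := measurable_endless.
have neg0 : P (\bigcup_n waiting M n @^-1` `]-oo, 0]) = 0%E.
  apply/eqP; rewrite eq_le measure_ge0 andbT.
  apply: (le_trans (measure_sigma_subadditive P mn _ (@subset_refl _ _))).
    exact: bigcupT_measurable.
  rewrite eseries0// => n _ _.
  transitivity ((1 - expR (- lambda * 0))%:E : \bar R); first exact: waiting_le.
  by rewrite mulr0 expR0 subrr.
have e0 : P (endless 0 `|` endless 1) = 0%E.
  by rewrite measureU0//; exact: probability_endless.
rewrite measureU0//; last exact: measurableU.
exact: bigcupT_measurable.
Qed.

Lemma exit_time_stay x w : ~ exceptional w ->
  (exit_time M c L x y w = \sum_(k <oo) (stay M c L y k w)%:E)%E.
Proof.
move=> Nw.
have W0 k : 0 < waiting M k w.
  by rewrite ltNge; apply/negP => Wk; apply: Nw; left; exists k.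
have Ne : ~ endless (parity_offset (init_dir M w)) w.
  move=> h; apply: Nw; right; rewrite /parity_offset in h.
  by case: (odd _) h => h; [left|right].
have [k LW] : exists k, L / c < waiting M (k.*2 + parity_offset (init_dir M w)) w.
  apply: contrapT => no; apply: Ne => k; rewrite leNgt; apply/negP => LW.
  by apply: no; exists k.
have [n [ins outs]] := exists_exit_step c_gt0 y_strip (vertical_step k w) LW.
exact: exit_time_sum_stay ins outs.
Qed.

End almost_sure_exit.

(** * Mean exit times *)

Section mean_exit_times.
Context d (Omega : measurableType d) (R : realType) (P : probability Omega R).
Variables (lambda : R) (M : orthogonal_motion P lambda) (c L y : R).
Hypotheses (lambda_gt0 : 0 < lambda) (c_gt0 : 0 < c) (L_gt0 : 0 < L).
Hypothesis y_strip : 0 <= y <= L.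
Local Notation inside := (inside M c L y).
Local Notation stay := (stay M c L y).
Local Notation remaining := (remaining M c L y).
Local Notation start j := (init_dir M @^-1` [set j]).

Lemma exit_time_ge0 x w : (0 <= exit_time M c L x y w)%E.
Proof.
by apply: le_ereal_inf_tmp => _ [t [t0 _] <-]; rewrite lee_fin ltW.
Qed.

Definition total_stay (w : Omega) : \bar R := (\sum_(k <oo) (stay k w)%:E)%E.

Lemma total_stay_ge0 w : (0 <= total_stay w)%E.
Proof. by apply: nneseries_ge0 => k _ _; rewrite lee_fin stay_ge0. Qed.

Lemma measurable_EFin_stay k : measurable_fun setT (fun w => (stay k w)%:E).
Proof. by apply/measurable_EFinP; exact: measurable_stay. Qed.

Lemma measurable_total_stay : measurable_fun setT total_stay.
Proof.
apply: ge0_emeasurable_sum => [k w _ _|k _]; first by rewrite lee_fin stay_ge0.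
exact: measurable_EFin_stay.
Qed.

Lemma integral_exit_time x (D : set Omega) : measurable D ->
  (\int[P]_(w in D) exit_time M c L x y w = \int[P]_(w in D) total_stay w)%E.
Proof.
move=> mD; apply: (@ge0_integral_eq_off_null _ _ _ P D (exceptional M c L)) => //.
- exact: measurable_exceptional.
- exact: probability_exceptional.
- exact/measurable_funTS/measurable_total_stay.
- exact: exit_time_ge0.
- exact: total_stay_ge0.
- by move=> w _ Nw; exact: exit_time_stay.
Qed.

Definition mean_bound : R :=
  lambda * L * L / c ^+ 2 + (2 * L / c + (lambda * L + c) / (lambda * c)).

Lemma mean_dir_le j h : 0 <= h <= L -> mean_dir lambda c L j h <= mean_bound.
Proof.
move=> /andP[h0 hL].
have p1 : lambda * h * (L - h) / c ^+ 2 <= lambda * L * L / c ^+ 2.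
  rewrite ler_pM2r ?invr_gt0 ?exprn_gt0// -!mulrA ler_pM2l// ler_pM ?subr_ge0//.
  by rewrite lerBlDr lerDl.
have p2 : 0 <= (lambda * L + c) / (lambda * c).
  by apply/ltW/divr_gt0; [apply: addr_gt0 => //; exact: mulr_gt0|exact: mulr_gt0].
have p3 : 0 <= 2 * L / c by apply/ltW/divr_gt0 => //; exact: mulr_gt0.
rewrite /mean_dir; case: ifP => _; last case: ifP => _; rewrite lerD//.
- rewrite (@le_trans _ _ (2 * L / c))// ?lerDl//.
  by rewrite ler_pM2r ?invr_gt0// ler_pM2l// lerBlDr lerDl.
- rewrite (@le_trans _ _ (2 * L / c))// ?lerDl//.
  by rewrite ler_pM2r ?invr_gt0// ler_pM2l.
- by rewrite lerDr.
Qed.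

(** Being inside up to the event 2 m + 1 forces m vertical phases to be
    shorter than L/c. *)
Lemma integral_remaining_le j m :
  (\int[P]_(w in start j) (remaining m.*2.+1 w)%:E <=
   (mean_bound * (1 - expR (- lambda * (L / c))) ^+ m)%:E)%E.
Proof.
have Lc0 : 0 <= L / c by rewrite divr_ge0 ?ltW.
have b0 : 0 <= mean_bound.
  have yb := mean_dir_le 0 y_strip.
  by apply: le_trans yb; exact: mean_dir_ge0.
have mS := @measurable_short_waits _ _ _ _ _ M (L / c) (parity_offset j) m.
have mr : measurable_fun setT (fun w => (remaining m.*2.+1 w)%:E).
  by apply/measurable_EFinP; exact: measurable_remaining.
have mA := init_dir_measurable_preimage M [set j].
rewrite EFinM -(probability_short_waits M lambda_gt0 (parity_offset j) m Lc0).
rewrite -integral_cst//.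
rewrite [leLHS]integral_mkcond [leRHS]integral_mkcond.
apply: ge0_le_integral => //.
- by move=> w _; rewrite patchE; case: ifP => // _; rewrite lee_fin remaining_ge0.
- exact/(measurable_restrictT _ _).1/measurable_funTS.
- exact/(measurable_restrictT _ _).1.
- move=> w _; rewrite !patchE; case: ifPn => [/set_mem /= jw|_]; last first.
    by case: ifP => // _; rewrite lee_fin.
  rewrite /remaining; case: ifPn => [ins|_]; last first.
    by case: ifP => // _; rewrite lee_fin.
  rewrite ifT; last first.
    by rewrite inE -jw; exact: inside_short_waits ins.
  by rewrite lee_fin mean_dir_le// inside_height.
Qed.

(** The telescoped one-step equations. *)
Lemma partial_stays j n :
  (\sum_(0 <= k < n) \int[P]_(w in start j) (stay k w)%:E +
   \int[P]_(w in start j) (remaining n w)%:E =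
   \int[P]_(w in start j) (remaining 0 w)%:E)%E.
Proof.
elim: n => [|n IH]; first by rewrite big_geq// add0e.
by rewrite big_nat_recr//= -addeA integral_step.
Qed.

(** The upper bound holds for every partial sum; for the lower bound, the
    missing term in the telescoped sum is arbitrarily small. *)
Lemma integral_total_stay j :
  (\int[P]_(w in start j) total_stay w = (mean_dir lambda c L j y / 4)%:E)%E.
Proof.
have mA := init_dir_measurable_preimage M [set j].
have stay_int0 k : (0 <= \int[P]_(w in start j) (stay k w)%:E)%E.
  by apply: integral_ge0 => w _; rewrite lee_fin stay_ge0.
have -> : (mean_dir lambda c L j y / 4)%:E =
    (\int[P]_(w in start j) (remaining 0 w)%:E)%E.
  transitivity (\int[P]_(w in start j) (mean_dir lambda c L j y)%:E)%E.
    by rewrite integral_cst//= init_dir_uniform.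
  by apply: eq_integral => w /set_mem /= jw; rewrite /remaining /= jw.
rewrite integral_nneseries//; last 2 first.
- by move=> k; exact/measurable_funTS/measurable_EFin_stay.
- by move=> k w _; rewrite lee_fin stay_ge0.
apply/eqP; rewrite eq_le; apply/andP; split.
  apply: lime_le; first by apply: is_cvg_nneseries => k _ _; exact: stay_int0.
  apply: nearW => n /=; rewrite -(partial_stays j n) leeDl//.
  by apply: integral_ge0 => w _; rewrite lee_fin remaining_ge0.
apply/lee_addgt0Pr => r r0.
have [m mr] := small_ratio_power lambda_gt0 c_gt0 L_gt0 mean_bound r0.
rewrite -(partial_stays j m.*2.+1); apply: leeD.
  by apply: nneseries_lim_ge => k _ _; exact: stay_int0.
by rewrite (le_trans (integral_remaining_le j m))// lee_fin.
Qed.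

Lemma mean_exit_dirE j x :
  mean_exit_dir M c L j x y = (mean_dir lambda c L j y)%:E.
Proof.
rewrite /mean_exit_dir /cond_expectation integral_exit_time; last first.
  exact: init_dir_measurable_preimage.
rewrite integral_total_stay init_dir_uniform /= invrK -EFinM.
by congr _%:E; field.
Qed.

Lemma mean_exitE x : mean_exit M c L x y =
  (\sum_(j : 'Z_4) (mean_dir lambda c L j y / 4)%:E)%E.
Proof.
rewrite /mean_exit integral_exit_time//.
have -> : [set: Omega] = \big[setU/set0]_(j : 'Z_4) start j.
  apply/seteqP; split => // w _; rewrite -bigcup_seq.
  by exists (init_dir M w) => //=; rewrite mem_index_enum.
rewrite ge0_integral_bigsetU//.
- by apply: eq_bigr => j _; exact: integral_total_stay.
- by move=> j; exact: init_dir_measurable_preimage.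
- exact: index_enum_uniq.
- by move=> i k _ _ [w [/= -> ->]].
- exact/measurable_funTS/measurable_total_stay.
- by move=> w _; exact: total_stay_ge0.
Qed.

End mean_exit_times.

Theorem theorem7 (R : realType) (d : measure_display) (Omega : measurableType d)
    (P : probability Omega R) (lambda c L : R)
    (lambda_gt0 : 0 < lambda) (c_gt0 : 0 < c) (L_gt0 : 0 < L)
    (M : orthogonal_motion P lambda) :
  let h_ (j : 'Z_4) (x y : R) := mean_exit_dir M c L j x y in
  let h (x y : R) := mean_exit M c L x y in
  forall x y : R, strip L (x, y) ->
    (h_ 1 x y = (lambda * y * (L - y) / c ^+ 2 + 2 * (L - y) / c)%:E /\
     h_ 3 x y = (lambda * y * (L - y) / c ^+ 2 + 2 * y / c)%:E) /\
    (h_ 0 x y = (lambda * y * (L - y) / c ^+ 2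
                 + (lambda * L + c) / (lambda * c))%:E /\
     h_ 2 x y = (lambda * y * (L - y) / c ^+ 2
                 + (lambda * L + c) / (lambda * c))%:E /\
     h x y = (lambda * y * (L - y) / c ^+ 2
              + (2 * lambda * L + c) / (2 * lambda * c))%:E).
Proof.
move=> h_ h x y y_strip.
rewrite /h_ /h !mean_exit_dirE// mean_exitE//.
split; [by split|split; [by []|split; [by []|]]].
rewrite sumEFin; congr _%:E.
rewrite !big_ord_recl big_ord0 /mean_dir /= /mean_up /mean_down /mean_horizontal.
by field; rewrite !gt_eqF.
Qed.
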